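(* Let $\mathfrak u$ be a non-principal ultrafilter on $\mathbb N$, $(\lambda_k)\subset\mathbb R$ a sequence with $\lambda_k\to\infty$, $(\ast_k)\subset\mathbb H^2$ a sequence of points, and let $T^{\mathfrak u}:=\mathrm{Cone}^{\mathfrak u}(\mathbb H^2,(\lambda_k),(\ast_k))$ be the corresponding asymptotic cone of the hyperbolic plane. Let $[P_k]^{\mathfrak u}\in T^{\mathfrak u}$ and let $\mathcal G_{T^{\mathfrak u}}([P_k]^{\mathfrak u})$ be the set of germs of oriented segments at $[P_k]^{\mathfrak u}$. The map $$or^{\mathfrak u}([P_k]^{\mathfrak u})\colon \big(\mathcal G_{T^{\mathfrak u}}([P_k]^{\mathfrak u})\big)^3\to\{-1,0,1\},$$ $$([x_k]^{\mathfrak u},[y_k]^{\mathfrak u},[z_k]^{\mathfrak u})\mapsto\begin{cases}0&\text{if }\mathrm{Card}\{[x_k]^{\mathfrak u},[y_k]^{\mathfrak u},[z_k]^{\mathfrak u}\}\le2,\\ \lim_{\mathfrak u}or(P_k)(x_k,y_k,z_k)&\text{otherwise,}\end{cases}$$ (where germs are denoted by points representing them, and the cardinality is that of the set of germs) is a cyclic order on $\mathcal G_{T^{\mathfrak u}}([P_k]^{\mathfrak u})$, where $or(P_k)$ is the cyclic order on $\mathcal G_{\mathbb H^2}(P_k)$ given by the standard orientation on $\mathbb H^2$. Hence $or^{\mathfrak u}$ defines an orientation on $T^{\mathfrak u}$.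
   Context: **Asymptotic cone.** $\mathrm{Cone}^{\mathfrak u}(\mathbb H^2,(\lambda_k),(\ast_k))$ is the set of sequences $(x_k)\in(\mathbb H^2)^{\mathbb N}$ with $\lim_{\mathfrak u}\lambda_k^{-1}\mathrm{dist}_{\mathbb H^2}(x_k,\ast_k)<\infty$, modulo $(x_k)\sim(y_k)$ iff $\lim_{\mathfrak u}\lambda_k^{-1}\mathrm{dist}_{\mathbb H^2}(x_k,y_k)=0$, with distance $\mathrm{dist}([x_k]^{\mathfrak u},[y_k]^{\mathfrak u})=\lim_{\mathfrak u}\lambda_k^{-1}\mathrm{dist}_{\mathbb H^2}(x_k,y_k)$. It is an $\mathbb R$-tree. **Germs.** For $X$ an $\mathbb R$-tree or $\mathbb H^2$ and $P\in X$, $\mathcal G_X(P)$ is the set of equivalence classes of nondegenerate oriented geodesic segments based at $P$, two being equivalent iff they agree on some $[0,\varepsilon)$, $\varepsilon>0$. A point $x\in X\setminus\{P\}$ represents the germ of the segment from $P$ to $x$, and every germ is represented by such a point; one writes $x$ for this germ. (If $[x_k]^{\mathfrak u}\ne[P_k]^{\mathfrak u}$ then $x_k\ne P_k$ for $\mathfrak u$-almost every $k$.) **Cyclic order, orientation.** A cyclic order on a set $\Omega$ is $o\colon\Omega^3\to\{-1,0,1\}$ with (1) $o(z_1,z_2,z_3)=0$ iff $\mathrm{Card}\{z_1,z_2,z_3\}\le2$; (2) $o(z_1,z_2,z_3)=o(z_2,z_3,z_1)=-o(z_1,z_3,z_2)$; (3) $o(z_1,z_2,z_3)=1=o(z_1,z_3,z_4)$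 implies $o(z_1,z_2,z_4)=1$. An orientation of an $\mathbb R$-tree $T$ is the data of a cyclic order on $\mathcal G_T(P)$ for every $P\in T$. The standard orientation on $\mathbb H^2$ (Poincaré disc) is the counterclockwise cyclic order $o_{\mathbb R}(z_1,z_2,z_3)=\mathrm{sgn}\det(z_2-z_1,z_3-z_2)$ on $\partial_\infty\mathbb H^2=\mathbb S^1$; it gives a cyclic order $or(P)$ on each $\mathcal G_{\mathbb H^2}(P)$ through the bijection $\mathcal G_{\mathbb H^2}(P)\cong\partial_\infty\mathbb H^2$ sending a germ to the endpoint of the geodesic ray from $P$ it determines. *)

(* Defs.v *)
From HB Require Import structures.
From mathcomp Require Import all_boot all_order all_algebra.
From mathcomp Require Import finmap.
From mathcomp Require Import all_classical all_reals all_analysis.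
From mathcomp Require Import ring lra.

Set Implicit Arguments.
Unset Strict Implicit.
Unset Printing Implicit Defensive.

Import Order.TTheory GRing.Theory Num.Theory.
Import numFieldNormedType.Exports.

Local Open Scope classical_set_scope.
Local Open Scope ring_scope.
Local Open Scope quotient_scope.

Section HyperbolicPlane.
Context {R : realType}.

Definition sqnorm2 (z : R * R) : R := z.1 ^+ 2 + z.2 ^+ 2.

Definition arcosh (x : R) : R := ln (x + Num.sqrt (x ^+ 2 - 1)).

Lemma arcosh1 : arcosh 1 = 0.
Proof. by rewrite /arcosh expr1n subrr sqrtr0 addr0 ln1. Qed.

Lemma arcosh_eq0 x : 1 <= x -> arcosh x = 0 -> x = 1.
Proof.
move=> x1 /eqP; rewrite /arcosh ln_eq0; last first.
  by rewrite (lt_le_trans ltr01)// (le_trans x1)// lerDl sqrtr_ge0.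
have := sqrtr_ge0 (x ^+ 2 - 1) => s0 /eqP xs.
by apply/eqP; rewrite eq_le x1 andbT -xs lerDl.
Qed.

Lemma arcosh_le_add a b c : 1 <= a -> 1 <= b -> 1 <= c ->
  (c - a * b) ^+ 2 <= (a ^+ 2 - 1) * (b ^+ 2 - 1) ->
  arcosh c <= arcosh a + arcosh b.
Proof.
move=> a1 b1 c1 h.
have pos x : 1 <= x -> 0 < x + Num.sqrt (x ^+ 2 - 1).
  by move=> x1; have := sqrtr_ge0 (x ^+ 2 - 1); lra.
rewrite /arcosh -lnM ?posrE ?pos// ler_ln ?posrE ?pos ?mulr_gt0 ?pos//.
have sq x : 1 <= x -> Num.sqrt (x ^+ 2 - 1) ^+ 2 = x ^+ 2 - 1.
  by move=> x1; rewrite sqr_sqrtr//; nra.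
set sa := Num.sqrt (a ^+ 2 - 1); set sb := Num.sqrt (b ^+ 2 - 1).
have sa2 : sa ^+ 2 = a ^+ 2 - 1 by exact: sq.
have sb2 : sb ^+ 2 = b ^+ 2 - 1 by exact: sq.
have sa0 : 0 <= sa by exact: sqrtr_ge0.
have sb0 : 0 <= sb by exact: sqrtr_ge0.
have le1 : c <= a * b + sa * sb.
  rewrite -lerBlDl (le_trans (ler_norm _))// -ler_sqr ?nnegrE ?mulr_ge0//.
  by rewrite real_normK ?num_real// exprMn sa2 sb2.
have ge0 : 0 <= a * sb + sa * b by nra.
have le2 : Num.sqrt (c ^+ 2 - 1) <= a * sb + sa * b.
  rewrite -(ler_sqr (sqrtr_ge0 _) ge0) sq//.
  have -> : (a * sb + sa * b) ^+ 2 = (a * b + sa * sb) ^+ 2 - 1.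
    by rewrite !sqrrD !exprMn sa2 sb2; ring.
  by rewrite lerD2r ler_sqr ?nnegrE//; nra.
nra.
Qed.

End HyperbolicPlane.

(* Poincare disc model: the open unit disc of R^2. *)
Record hplane (R : realType) := HPlane {
  hval :> R * R ;
  hval_lt1 : sqnorm2 hval < 1 }.

HB.instance Definition _ (R : realType) := [isSub of hplane R for @hval R].
HB.instance Definition _ (R : realType) := [Choice of hplane R by <:].

Section HyperbolicMetric.
Context {R : realType}.
Implicit Types p q r : hplane R.

(* The distance of curvature -1 :
   cosh d(p, q) = 1 + 2 |p - q|^2 / ((1 - |p|^2) (1 - |q|^2)). *)
Definition hcosh_dist p q : R :=
  1 + 2 * sqnorm2 (hval p - hval q)
        / ((1 - sqnorm2 (hval p)) * (1 - sqnorm2 (hval q))).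

Definition hdist p q : R := arcosh (hcosh_dist p q).

Let den_gt0 p : 0 < 1 - sqnorm2 (hval p).
Proof. by rewrite subr_gt0 hval_lt1. Qed.

Let sqnorm2_ge0 (z : R * R) : 0 <= sqnorm2 z.
Proof. by rewrite addr_ge0// sqr_ge0. Qed.

Lemma hcosh_dist_ge1 p q : 1 <= hcosh_dist p q.
Proof.
by rewrite lerDl divr_ge0 ?mulr_ge0 ?sqnorm2_ge0// ltW.
Qed.

Lemma hdistxx p : hdist p p = 0.
Proof.
by rewrite /hdist /hcosh_dist subrr /sqnorm2/= expr0n addr0 mulr0 mul0r addr0
  arcosh1.
Qed.

Lemma hdist_eq0 p q : hdist p q = 0 -> p = q.
Proof.
move=> /(arcosh_eq0 (hcosh_dist_ge1 p q)) /eqP.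
rewrite /hcosh_dist -subr_eq0 addrAC subrr add0r mulf_eq0 invr_eq0 !mulf_eq0.
rewrite pnatr_eq0 (gt_eqF (den_gt0 p)) (gt_eqF (den_gt0 q)) !orbF /= paddr_eq0 ?sqr_ge0// !sqrf_eq0 => /andP[].
rewrite /= !subr_eq0 => /eqP e1 /eqP e2; apply: val_inj => /=.
by rewrite (surjective_pairing (hval p)) e1 e2 -surjective_pairing.
Qed.

Lemma hdist_sym p q : hdist p q = hdist q p.
Proof.
rewrite /hdist /hcosh_dist (mulrC (1 - sqnorm2 (hval p))).
by rewrite /sqnorm2/= -(sqrrN ((hval p).1 - _)) -(sqrrN ((hval p).2 - _)) !opprB.
Qed.

(* With a, b, c the hyperbolic cosines of the three distances,
   1 + 2abc - a^2 - b^2 - c^2 is the square of the determinant of the three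
   points lifted to the hyperboloid. *)
Lemma hdist_triangle q p r : hdist p r <= hdist p q + hdist q r.
Proof.
apply: arcosh_le_add; rewrite ?hcosh_dist_ge1//.
rewrite -subr_ge0.
move: (den_gt0 p) (den_gt0 q) (den_gt0 r).
rewrite /hcosh_dist /sqnorm2/=.
case: (hval p) (hval q) (hval r) => [p1 p2] [q1 q2] [r1 r2] /=.
move=> p0 q0 r0.
set l := (X in 0 <= X).
suff -> : l = (4 *
    ((1 + (p1 ^+ 2 + p2 ^+ 2)) * (q1 * r2 - q2 * r1)
     - (1 + (q1 ^+ 2 + q2 ^+ 2)) * (p1 * r2 - p2 * r1)
     + (1 + (r1 ^+ 2 + r2 ^+ 2)) * (p1 * q2 - p2 * q1))
   / ((1 - (p1 ^+ 2 + p2 ^+ 2)) * (1 - (q1 ^+ 2 + q2 ^+ 2))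
      * (1 - (r1 ^+ 2 + r2 ^+ 2)))) ^+ 2 by exact: sqr_ge0.
by rewrite /l; field; rewrite !gt_eqF.
Qed.

HB.instance Definition _ :=
  isMetric.Build R (hplane R) hdistxx hdist_eq0 hdist_sym hdist_triangle.

End HyperbolicMetric.

Definition nonprincipal (T : Type) (u : set_system T) : Prop :=
  forall x : T, u <> principal_filter x.

Section ScaledDistance.
Context {R : realType} (u : set_system nat) (lam : nat -> R).
Implicit Types x y z : nat -> hplane R.

Definition scaled_dist x y : nat -> R := fun k => (lam k)^-1 * mdist (x k) (y k).

(* The limit along an ultrafilter of a sequence that is almost everywhere
   nonnegative exists in [0, +oo]; it is < +oo iff the sequence converges
   in R. *)
Definition cone_finite (b x : nat -> hplane R) : Prop :=
  cvg (scaled_dist x b @ u).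

Lemma scaled_distC x y : scaled_dist x y = scaled_dist y x.
Proof. by apply/funext => k; rewrite /scaled_dist metric_sym. Qed.

Lemma scaled_distxx x : scaled_dist x x = fun=> 0.
Proof. by apply/funext => k; rewrite /scaled_dist mdistxx mulr0. Qed.

Context (uU : UltraFilter u) (uN : nonprincipal u).
Context (lamoo : lam @ \oo --> +oo).

Lemma ultra_bounded_cvg (f : nat -> R) (m : R) :
  (\forall k \near u, 0 <= f k <= m) -> cvg (f @ u).
Proof.
move=> fm.
have fU : UltraFilter (f @ u).
  split=> [|G GG fG]; first exact: fmap_proper_filter.
  rewrite predeqE => A; split; last exact: fG.
  move=> GA; have [//|fA] := in_ultra_setVsetC (f @^-1` A) uU.
  have /fG GnA : (f @ u) (~` A) by [].
  have GAnA : G (A `&` ~` A) by exact: filterI.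
  by have [a []] := filter_ex GAnA.
have := @segment_compact R 0 m; rewrite compact_ultra => /(_ _ fU) [].
  by apply: filterS fm => k; rewrite /= in_itv.
by move=> l [_ fl]; apply/cvg_ex; exists l.
Qed.

Lemma nonprincipal_cofinite (A : set nat) : \oo A -> u A.
Proof.
have nu n : u (~` [set n]).
  have [un|//] := in_ultra_setVsetC [set n] uU.
  have /(_ (principal_filter_ultra n)) un_max := @max_filter _ (principal_filter n).
  exfalso; apply: (uN (x := n)); apply: un_max.
  by move=> B; rewrite principal_filterP => Bn; apply: filterS un => _ ->.
case=> N _ NA.
have : u [set k | (N <= k)%N].
  elim: N {NA} => [|N IH]; first by apply: filterS filterT.
  apply: filterS (filterI IH (nu N)) => k [/= Nk kN].
  by rewrite ltn_neqAle Nk andbT; apply/eqP => Nk'; apply: kN.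
exact: filterS.
Qed.

Lemma scale_gt0 : \forall k \near u, 0 < lam k.
Proof. by apply: nonprincipal_cofinite; move/cvgryPgt : lamoo; exact. Qed.

Lemma scaled_dist_ge0 x y : \forall k \near u, 0 <= scaled_dist x y k.
Proof.
by apply: filterS scale_gt0 => k k0; rewrite mulr_ge0 ?mdist_ge0// invr_ge0 ltW.
Qed.

Lemma scaled_dist_triangle y x z : \forall k \near u,
  scaled_dist x z k <= scaled_dist x y k + scaled_dist y z k.
Proof.
apply: filterS scale_gt0 => k k0; rewrite -mulrDr ler_wpM2l ?metric_triangle//.
by rewrite invr_ge0 ltW.
Qed.

Lemma scaled_dist_cvg b x y : cone_finite b x -> cone_finite b y ->
  cvg (scaled_dist x y @ u).
Proof.
rewrite /cone_finite => /cvg_ex[/= l xl]; rewrite scaled_distC.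
move=> /cvg_ex[/= m ym].
apply: (@ultra_bounded_cvg _ (l + m + 1)).
have := scaled_dist_triangle b x y.
have : \forall k \near u, scaled_dist x b k + scaled_dist b y k <= l + m + 1.
  have xym : (scaled_dist x b + scaled_dist b y) @ u --> l + m by exact: cvgD.
  move/cvgrPdist_le : xym => /(_ 1 ltr01).
  by apply: filterS => k; rewrite ler_distlC /= => /andP[].
apply: filterS3 (scaled_dist_ge0 x y) => k ge0 le1 le2.
by rewrite ge0/= (le_trans le2).
Qed.

End ScaledDistance.

Section Cone.
Context {R : realType} (u : set_system nat) (lam : nat -> R).

(* The sequences at finite distance from the observation points [b]. *)
Definition cone_seq (b : nat -> hplane R) : Type :=
  {x : nat -> hplane R | `[< cone_finite u lam b x >]}.
HB.instance Definition _ b := Choice.on (cone_seq b).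

Definition cone_sequence b (x : cone_seq b) : nat -> hplane R := val x.
Coercion cone_sequence : cone_seq >-> Funclass.

Lemma cone_seqP b (x : cone_seq b) : cone_finite u lam b x.
Proof. exact/asboolP/(proj2_sig x). Qed.

Context (uU : UltraFilter u) (uN : nonprincipal u).
Context (lamoo : lam @ \oo --> +oo) (b : nat -> hplane R).

Lemma cone_seq_cvg (x y : cone_seq b) : cvg (scaled_dist lam x y @ u).
Proof.
by apply: (scaled_dist_cvg uU uN lamoo (b := b)); exact: cone_seqP.
Qed.

Definition cone_rel (x y : cone_seq b) : bool :=
  `[< scaled_dist lam x y @ u --> (0 : R) >].

Let cone_rel_refl : reflexive cone_rel.
Proof. by move=> x; apply/asboolP; rewrite scaled_distxx; exact: cvg_cst. Qed.

Let cone_rel_sym : symmetric cone_rel.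
Proof. by move=> x y; rewrite /cone_rel scaled_distC. Qed.

Let cone_rel_trans : transitive cone_rel.
Proof.
move=> y x z /asboolP xy /asboolP yz; apply/asboolP.
have : (scaled_dist lam x y + scaled_dist lam y z) @ u --> (0 : R).
  by rewrite -[0]addr0; exact: cvgD.
move=> xyz; apply: (squeeze_cvgr _ (cvg_cst 0)) xyz.
apply: filterS2 (scaled_dist_ge0 uU uN lamoo x z)
  (scaled_dist_triangle uU uN lamoo y x z) => k ge0 le.
by rewrite ge0.
Qed.

Canonical cone_rel_equiv :=
  EquivRel cone_rel cone_rel_refl cone_rel_sym cone_rel_trans.

Definition cone : Type := {eq_quot cone_rel}.
HB.instance Definition _ := Choice.on cone.
HB.instance Definition _ := EqQuotient.on cone.

Definition cone_dist (x y : cone) : R :=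
  lim (scaled_dist lam (repr x) (repr y) @ u).

Let lim_le (x y z : cone_seq b) :
  lim (scaled_dist lam x z @ u) <=
  lim (scaled_dist lam x y @ u) + lim (scaled_dist lam y z @ u).
Proof.
rewrite -limD; [|exact: cone_seq_cvg..].
apply: ler_lim; [exact: cone_seq_cvg|by apply: is_cvgD; exact: cone_seq_cvg|].
exact: scaled_dist_triangle.
Qed.

Let cone_relP (x y : cone_seq b) :
  reflect (lim (scaled_dist lam x y @ u) = 0) (cone_rel x y).
Proof.
apply: (iffP (asboolP _)) => [|<-]; [exact: cvg_lim|exact: cone_seq_cvg].
Qed.

Lemma cone_dist_pi (x y : cone_seq b) :
  cone_dist (\pi_cone x) (\pi_cone y) = lim (scaled_dist lam x y @ u).
Proof.
have xx (z : cone_seq b) : cone_rel z (repr (\pi_cone z)).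
  by rewrite -[cone_rel _ _](eqmodE cone_rel_equiv) reprK.
have /cone_relP x0 := xx x; have /cone_relP y0 := xx y.
have x0' := x0; rewrite scaled_distC in x0'.
have y0' := y0; rewrite scaled_distC in y0'.
apply/eqP; rewrite eq_le; apply/andP; split.
  rewrite (le_trans (lim_le _ x _))// x0' add0r.
  by rewrite (le_trans (lim_le _ y _))// y0 addr0.
rewrite (le_trans (lim_le _ (repr (\pi_cone x)) _))// x0 add0r.
by rewrite (le_trans (lim_le _ (repr (\pi_cone y)) _))// y0' addr0.
Qed.

Let cone_distxx x : cone_dist x x = 0.
Proof. by rewrite /cone_dist scaled_distxx; exact: lim_cst. Qed.

Let cone_dist_eq0 x y : cone_dist x y = 0 -> x = y.
Proof.
move/cone_relP; rewrite -[cone_rel _ _](eqmodE cone_rel_equiv).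
by rewrite !reprK => /eqP.
Qed.

Let cone_dist_sym x y : cone_dist x y = cone_dist y x.
Proof. by rewrite /cone_dist scaled_distC. Qed.

Let cone_dist_triangle y x z : cone_dist x z <= cone_dist x y + cone_dist y z.
Proof. exact: lim_le. Qed.

HB.instance Definition _ := isMetric.Build R cone
  cone_distxx cone_dist_eq0 cone_dist_sym cone_dist_triangle.

End Cone.

Section Germs.
Context {R : realType} {X : metricType R}.

Definition geodesic_on (I : set R) (c : R -> X) : Prop :=
  forall s t, I s -> I t -> mdist (c s) (c t) = `|s - t|.

(* Only the values of [segment_fun] on [0, segment_length] are meaningful. *)
Record segment (P : X) := Segment {
  segment_length : R ;
  segment_fun :> R -> X ;
  segment_length_gt0 : 0 < segment_length ;
  segment_fun0 : segment_fun 0 = P ;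
  segment_geodesic : geodesic_on `[0, segment_length]%classic segment_fun }.

HB.instance Definition _ P := gen_eqMixin (segment P).
HB.instance Definition _ P := gen_choiceMixin (segment P).

Definition segment_end P (c : segment P) : X := c (segment_length c).

Definition agree_near0 (c c' : R -> X) : Prop :=
  exists2 e : R, 0 < e & forall t, 0 <= t < e -> c t = c' t.

Definition germ_rel P (c c' : segment P) : bool := `[< agree_near0 c c' >].

Let germ_rel_refl P : reflexive (@germ_rel P).
Proof. by move=> c; apply/asboolP; exists 1. Qed.

Let germ_rel_sym P : symmetric (@germ_rel P).
Proof.
have sym c c' : @germ_rel P c c' -> germ_rel c' c.
  by move=> /asboolP[e e0 cc']; apply/asboolP; exists e => // t /cc'.
by move=> c c'; apply/idP/idP; exact: sym.
Qed.

Let germ_rel_trans P : transitive (@germ_rel P).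
Proof.
move=> c' c c'' /asboolP[e e0 cc'] /asboolP[f f0 c'c'']; apply/asboolP.
exists (Num.min e f); rewrite ?lt_min ?e0// => t /andP[t0].
by rewrite lt_min => /andP[te tf]; rewrite cc' ?t0// c'c'' ?t0.
Qed.

Canonical germ_rel_equiv P :=
  EquivRel (@germ_rel P) (@germ_rel_refl P) (@germ_rel_sym P) (@germ_rel_trans P).

Definition germ (P : X) : Type := {eq_quot (@germ_rel P)}.
HB.instance Definition _ P := Choice.on (germ P).
HB.instance Definition _ P := EqQuotient.on (germ P).

(* The point [x] represents the germ [g]: [g] is the germ of a geodesic
   segment from [P] to [x]; this forces [x != P]. *)
Definition represents (P x : X) (g : germ P) : Prop :=
  exists2 c : segment P, segment_end c = x & g = \pi_(germ P) c.

Definition germ_point P (g : germ P) : X := segment_end (repr g).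

Lemma germ_pointP P (g : germ P) : represents (germ_point g) g.
Proof. by exists (repr g); rewrite ?reprK. Qed.

Lemma represents_neq P x (g : germ P) : represents x g -> x != P.
Proof.
case=> c <- _; rewrite eq_sym -mdist_gt0 -{1}(segment_fun0 c).
have l0 := segment_length_gt0 c.
rewrite (@segment_geodesic _ c) /= ?in_itv/= ?lexx ?ltW//.
by rewrite sub0r normrN gtr0_norm.
Qed.

End Germs.

Section CyclicOrder.
Variable W : choiceType.

Definition card_le2 (z1 z2 z3 : W) : bool := (#|` [fset z1; z2; z3]%fset| <= 2)%N.

Record cyclic_order (o : W -> W -> W -> int) : Prop := CyclicOrder {
  cyclic_order_range : forall z1 z2 z3, o z1 z2 z3 \in [:: -1; 0; 1] ;
  cyclic_order_eq0 : forall z1 z2 z3, o z1 z2 z3 = 0 <-> card_le2 z1 z2 z3 ;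
  cyclic_order_rot : forall z1 z2 z3, o z1 z2 z3 = o z2 z3 z1 ;
  cyclic_order_swap : forall z1 z2 z3, o z2 z3 z1 = - o z1 z3 z2 ;
  cyclic_order_trans : forall z1 z2 z3 z4,
    o z1 z2 z3 = 1 -> o z1 z3 z4 = 1 -> o z1 z2 z4 = 1 }.

End CyclicOrder.

Definition orientation {R : realType} (T : metricType R)
    (o : forall P : T, germ P -> germ P -> germ P -> int) : Prop :=
  forall P : T, cyclic_order (o P).

Section StandardOrientation.
Context {R : realType}.

Definition det2 (v w : R * R) : R := v.1 * w.2 - v.2 * w.1.

(* Counterclockwise cyclic order on the unit circle, the boundary at infinity
   of the Poincare disc. *)
Definition circle_order (z1 z2 z3 : R * R) : int :=
  sgz (det2 (z2 - z1) (z3 - z2)).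

(* [xi] is the endpoint at infinity, as a limit in R^2, of a geodesic ray
   from [P] with germ [g]. *)
Definition germ_endpoint_spec (P : hplane R) (g : germ P) (xi : R * R) : Prop :=
  exists c : R -> hplane R,
    [/\ c 0 = P, geodesic_on `[0, +oo[%classic c,
        agree_near0 (repr g) c & hval (c t) @[t --> +oo] --> xi].

Definition germ_endpoint (P : hplane R) (g : germ P) : R * R :=
  xget (0, 0) (germ_endpoint_spec g).

Definition hor (P : hplane R) (a b c : germ P) : int :=
  circle_order (germ_endpoint a) (germ_endpoint b) (germ_endpoint c).

(* [hor P] evaluated on points representing germs; the value 0 when one of the
   points is [P] is a dummy. *)
Definition hor_point (P x y z : hplane R) : int :=
  xget 0 [set v | exists a b c : germ P,
    [/\ represents x a, represents y b, represents z c & v = hor a b c]].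

End StandardOrientation.

(* Limit along [u] of a sequence with values in the discrete space [int]. *)
Definition ulim (u : set_system nat) (f : nat -> int) : int :=
  xget 0 [set v | \forall k \near u, f k = v].

Section LimitOrientation.
Context {R : realType} (u : set_system nat) (lam : nat -> R).
Context (uU : UltraFilter u) (uN : nonprincipal u).
Context (lamoo : lam @ \oo --> +oo) (b : nat -> hplane R).

Local Notation T := (cone uU uN lamoo b).

(* The formula is evaluated on chosen sequences representing [P] and points
   representing the germs. *)
Definition cone_or (P : T) (g1 g2 g3 : germ P) : int :=
  if card_le2 g1 g2 g3 then 0
  else ulim u (fun k => hor_point (repr P k)
    (repr (germ_point g1) k) (repr (germ_point g2) k) (repr (germ_point g3) k)).

End LimitOrientation.

(* Main.v *)
(* In coordinates adapted to a point P of the hyperbolic plane, a point x at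
   distance d is (cosh d, sinh d v) on the hyperboloid, with v a unit vector,
   and or(P)(x, y, z) is the sign of the Euclidean orientation of the three
   directions. By the law of cosines, 1 minus the cosine of the angle at P
   between x and y is comparable to exp(- 2 (x | y)_P) with (x | y)_P the
   Gromov product, and the squared orientation determinant is
   twice the product of the three quantities so obtained.
   The cone satisfies the four-point condition, as a limit of the Ptolemy
   inequality, so two germs differ iff the rescaled Gromov product of points
   representing them tends to 0. Hence, for three distinct germs, the
   determinant is at least exp(- o(lambda_k)), while replacing x_k by another
   representative of its germ changes it by at most exp(- c lambda_k): the sign
   is nonzero and stable. Replacing P_k by P'_k is harmless because, up to an
   error exp(- c lambda_k), the determinant is proportional to that of x_k,
   y_k, z_k on the hyperboloid, which does not involve P_k. The axioms then pass
   to the limit from the circle. *)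
Require Import Defs.
From HB Require Import structures.
From mathcomp Require Import all_boot all_order all_algebra.
From mathcomp Require Import finmap.
From mathcomp Require Import all_classical all_reals all_analysis.
From mathcomp Require Import ring lra.

Set Implicit Arguments.
Unset Strict Implicit.
Unset Printing Implicit Defensive.

Import Order.TTheory GRing.Theory Num.Theory.
Import numFieldNormedType.Exports.

Local Open Scope classical_set_scope.
Local Open Scope ring_scope.
Local Open Scope quotient_scope.

(** * Hyperbolic sine and cosine *)

Section HyperbolicFunctions.
Context {R : realType}.
Implicit Types s t : R.

Definition cosh t : R := (expR t + expR (- t)) / 2.
Definition sinh t : R := (expR t - expR (- t)) / 2.

Lemma cosh0 : cosh 0 = 1.
Proof. by rewrite /cosh oppr0 expR0; lra. Qed.

Lemma sinh0 : sinh 0 = 0.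
Proof. by rewrite /sinh oppr0 subrr mul0r. Qed.

Lemma coshN t : cosh (- t) = cosh t.
Proof. by rewrite /cosh opprK addrC. Qed.

Lemma cosh_norm t : cosh `|t| = cosh t.
Proof. by case: (ger0P t) => // _; rewrite coshN. Qed.

Lemma cosh_sinh2 t : cosh t ^+ 2 - sinh t ^+ 2 = 1.
Proof.
have := expRxMexpNx_1 t; rewrite /cosh /sinh.
by set a := expR t; set b := expR (- t) => ab; field: ab.
Qed.

Lemma coshB s t : cosh (s - t) = cosh s * cosh t - sinh s * sinh t.
Proof.
by rewrite /cosh /sinh opprB !expRD; field.
Qed.

Lemma sinh_gt0 t : 0 < t -> 0 < sinh t.
Proof.
by move=> t0; rewrite /sinh divr_gt0// subr_gt0 ltr_expR; lra.
Qed.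

Lemma sinh_ge0 t : 0 <= t -> 0 <= sinh t.
Proof. by rewrite le_eqVlt => /predU1P[<-|/sinh_gt0/ltW//]; rewrite sinh0. Qed.

Lemma cosh_ge1 t : 1 <= cosh t.
Proof.
have c0 : 0 < cosh t by rewrite divr_gt0// addr_gt0 ?expR_gt0.
have := cosh_sinh2 t; have := sqr_ge0 (sinh t); nra.
Qed.

Lemma coshK t : 0 <= t -> arcosh (cosh t) = t.
Proof.
move=> t0; have /eqP := cosh_sinh2 t; rewrite /arcosh subr_eq addrC -subr_eq =>
  /eqP ->.
rewrite sqrtr_sqr ger0_norm ?sinh_ge0// -[RHS]expRK; congr ln.
by rewrite /cosh /sinh; field.
Qed.

Lemma arcoshK c : 1 <= c -> cosh (arcosh c) = c.
Proof.
move=> c1; have s0 := sqrtr_ge0 (c ^+ 2 - 1).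
have s2 : Num.sqrt (c ^+ 2 - 1) ^+ 2 = c ^+ 2 - 1 by rewrite sqr_sqrtr//; nra.
have p : 0 < c + Num.sqrt (c ^+ 2 - 1) by lra.
rewrite /cosh expRN /arcosh lnK ?posrE//; apply/eqP.
rewrite -subr_eq0; apply/eqP; field: s2; exact: lt0r_neq0.
Qed.

End HyperbolicFunctions.

(** * The hyperboloid model and Lorentz boosts *)

Section LorentzBoosts.
Context {R : realType}.
Implicit Types (v w p : R * R) (x y z : R * (R * R)) (P Q : hplane R).

Definition dot2 v w : R := v.1 * w.1 + v.2 * w.2.

Definition mink x y : R := x.1 * y.1 - dot2 x.2 y.2.

(** The 3 by 3 determinant, expanded along the first coordinates. *)
Definition det3 x y z : R :=
  x.1 * det2 y.2 z.2 + y.1 * det2 z.2 x.2 + z.1 * det2 x.2 y.2.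

(* The Lorentz transformation carrying the apex (1, 0, 0) of the hyperboloid to
   the point that corresponds to [p] under stereographic projection. *)
Definition boost p y : R * (R * R) :=
  let n := 1 - sqnorm2 p in
  let s := 2 * (y.1 + dot2 p y.2) / n in
  (s - y.1, (y.2.1 + p.1 * s, y.2.2 + p.2 * s)).

Definition lift p : R * (R * R) := boost p (1, (0, 0)).

(** Stereographic projection from (-1, 0, 0), inverse to [lift] on the upper sheet of the
    hyperboloid. *)
Definition stereo y : R * R := (y.2.1 / (1 + y.1), y.2.2 / (1 + y.1)).

Lemma boostK p : sqnorm2 p < 1 -> cancel (boost p) (boost (- p)).
Proof.
rewrite -subr_gt0 /sqnorm2 => p1 [y0 [y1 y2]].
rewrite /boost /sqnorm2 /dot2 /= !sqrrN.
by congr (_, (_, _)); field; rewrite gt_eqF.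
Qed.

Lemma boostNK p : sqnorm2 p < 1 -> cancel (boost (- p)) (boost p).
Proof.
move=> p1; rewrite -{2}(opprK p); apply: boostK.
by rewrite /sqnorm2 /= !sqrrN.
Qed.

Lemma mink_boost p y z : sqnorm2 p < 1 ->
  mink (boost p y) (boost p z) = mink y z.
Proof.
rewrite -subr_gt0 /mink /boost /sqnorm2 /dot2 /= => p1.
by field; rewrite gt_eqF.
Qed.

Lemma det3_boost p x y z : sqnorm2 p < 1 ->
  det3 (boost p x) (boost p y) (boost p z) = det3 x y z.
Proof.
rewrite -subr_gt0 /det3 /det2 /boost /sqnorm2 /dot2 /= => p1.
by field; rewrite gt_eqF.
Qed.

Lemma sqnorm2_ge0 v : 0 <= sqnorm2 v.
Proof. by rewrite addr_ge0// sqr_ge0. Qed.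

Lemma sqnorm2N v : sqnorm2 (- v) = sqnorm2 v.
Proof. by rewrite /sqnorm2 /= !sqrrN. Qed.

Lemma dot2_sqr v w : dot2 v w ^+ 2 + det2 v w ^+ 2 = sqnorm2 v * sqnorm2 w.
Proof. by rewrite /dot2 /det2 /sqnorm2; ring. Qed.

(** The new first coordinate is a positive multiple of (1 + |p|^2) y_0 + 2 p.y. By Cauchy-Schwarz
    and 4 |p|^2 < (1 + |p|^2)^2, the first term dominates. *)
Lemma boost_gt0 p y : sqnorm2 p < 1 -> 0 <= mink y y -> 0 < y.1 ->
  0 < (boost p y).1.
Proof.
move=> p1 yy y0; rewrite /boost /=.
have -> : 2 * (y.1 + dot2 p y.2) / (1 - sqnorm2 p) - y.1 =
    ((1 + sqnorm2 p) * y.1 + 2 * dot2 p y.2) / (1 - sqnorm2 p).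
  by field; rewrite gt_eqF// subr_gt0.
rewrite divr_gt0// ?subr_gt0//.
have yy' : dot2 y.2 y.2 <= y.1 ^+ 2 by rewrite -subr_ge0 expr2.
have : (2 * dot2 p y.2) ^+ 2 < ((1 + sqnorm2 p) * y.1) ^+ 2.
  rewrite !exprMn (@le_lt_trans _ _ (4 * (sqnorm2 p * y.1 ^+ 2)))//.
    rewrite -natrX ler_pM2l// (@le_trans _ _ (sqnorm2 p * dot2 y.2 y.2))//.
      rewrite (_ : dot2 y.2 y.2 = sqnorm2 y.2) ?/dot2 -?expr2//.
      by rewrite -dot2_sqr lerDl sqr_ge0.
    by rewrite ler_wpM2l ?sqnorm2_ge0.
  rewrite mulrA ltr_pM2r ?exprn_gt0// -subr_gt0.
  by rewrite (_ : _ - _ = (1 - sqnorm2 p) ^+ 2) ?exprn_gt0 ?subr_gt0//; ring.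
have : 0 < (1 + sqnorm2 p) * y.1 by rewrite mulr_gt0// ltr_wpDr ?sqnorm2_ge0.
move: (_ * y.1) (2 * _) => Y X Y0 XY; rewrite ltNge; apply/negP => XY0; nra.
Qed.

(** The right-hand side is the formula of [hcosh_dist], so [lift] identifies the disc with the
    hyperboloid isometrically. *)
Lemma mink_lift p q : sqnorm2 p < 1 -> sqnorm2 q < 1 ->
  mink (lift p) (lift q) =
  1 + 2 * sqnorm2 (p - q) / ((1 - sqnorm2 p) * (1 - sqnorm2 q)).
Proof.
rewrite -!(subr_gt0 _ 1) /mink /lift /boost /sqnorm2 /dot2 /= => p1 q1.
by field; rewrite !gt_eqF.
Qed.

Lemma liftK p : sqnorm2 p < 1 -> stereo (lift p) = p.
Proof.
rewrite -!(subr_gt0 _ 1) /stereo /lift /boost /sqnorm2 /dot2 /= => p1.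
case: p p1 => p1 p2 /= p0; congr (_, _); field; rewrite gt_eqF //=; lra.
Qed.

Lemma stereo_lt1 y : mink y y = 1 -> 0 < y.1 -> sqnorm2 (stereo y) < 1.
Proof.
case: y => y0 [y1 y2]; rewrite /mink /dot2 /stereo /sqnorm2 /= => yy y00.
rewrite !expr_div_n -mulrDl ltr_pdivrMr ?exprn_gt0 ?addr_gt0//; nra.
Qed.

Lemma stereoK y : mink y y = 1 -> 0 < y.1 -> lift (stereo y) = y.
Proof.
case: y => y0 [y1 y2]; rewrite /mink /dot2 /= => yy y00.
rewrite /lift /boost /dot2 /= !mulr0 !addr0.
have -> : 1 - sqnorm2 (stereo (y0, (y1, y2))) = 2 / (1 + y0).
  rewrite /sqnorm2 /stereo /= !expr_div_n -mulrDl.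
  have -> : y1 ^+ 2 + y2 ^+ 2 = (y0 - 1) * (y0 + 1) by lra.
  by field; lra.
by congr (_, (_, _)); field; lra.
Qed.

End LorentzBoosts.

(** * Polar coordinates around a point *)

Section PolarCoordinates.
Context {R : realType}.
Implicit Types (v w : R * R) (P x y z : hplane R) (s t : R).

(** Hyperboloid coordinates of [x] after the boost that moves [P] to the apex. *)
Definition frame P x : R * (R * R) := boost (- hval P) (lift (hval x)).

Definition scale2 t v : R * R := (t * v.1, t * v.2).

(* The default value [P] is reached at most when [v] is not a unit vector. *)
Definition polar P t v : hplane R :=
  insubd P (stereo (boost P (cosh t, scale2 (sinh t) v))).

(** The unit direction at [P] of the geodesic towards [x], meaningful only for [x != P]. *)
Definition dir P x : R * R := scale2 (sinh (hdist P x))^-1 (frame P x).2.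

Lemma scale2K t v : t != 0 -> scale2 t (scale2 t^-1 v) = v.
Proof.
by move=> t0; rewrite /scale2 /= !mulrA divff// !mul1r -surjective_pairing.
Qed.

Lemma sqnorm2_scale2 t v : sqnorm2 (scale2 t v) = t ^+ 2 * sqnorm2 v.
Proof. by rewrite /scale2 /sqnorm2 /= !exprMn mulrDr. Qed.

Lemma cosh_hdist x y : cosh (hdist x y) = hcosh_dist x y.
Proof. exact/arcoshK/hcosh_dist_ge1. Qed.

Lemma hdist_ge0 x y : 0 <= hdist x y.
Proof. exact: (@mdist_ge0 R (hplane R)). Qed.

Lemma hdist_gt0 x y : (0 < hdist x y) = (x != y).
Proof. exact: (@mdist_gt0 R (hplane R)). Qed.

Lemma mink_frame P x y : mink (frame P x) (frame P y) = cosh (hdist x y).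
Proof.
rewrite cosh_hdist mink_boost ?sqnorm2N ?hval_lt1//.
by rewrite mink_lift ?hval_lt1.
Qed.

Lemma framexx P : frame P P = (1, (0, 0)).
Proof. by rewrite /frame /lift boostK// hval_lt1. Qed.

Lemma frame1 P x : (frame P x).1 = cosh (hdist P x).
Proof.
by rewrite -(mink_frame P) framexx /mink /dot2 /= !mul0r addr0 subr0 mul1r.
Qed.

Lemma frame_inj P : injective (frame P).
Proof.
move=> x y /(can_inj (boostNK (hval_lt1 P))) xy; apply: val_inj => /=.
by rewrite -(liftK (hval_lt1 x)) xy liftK// hval_lt1.
Qed.

Lemma sqnorm2_frame P x : sqnorm2 (frame P x).2 = sinh (hdist P x) ^+ 2.
Proof.
have := mink_frame P x x; rewrite hdistxx cosh0 /mink frame1.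
by have := cosh_sinh2 (hdist P x); rewrite /dot2 /sqnorm2; lra.
Qed.

Lemma frame_dir P x : x != P ->
  frame P x = (cosh (hdist P x), scale2 (sinh (hdist P x)) (dir P x)).
Proof.
rewrite eq_sym -hdist_gt0 => /sinh_gt0/lt0r_neq0 s0.
by rewrite /dir scale2K// -frame1 -surjective_pairing.
Qed.

Lemma dir_unit P x : x != P -> sqnorm2 (dir P x) = 1.
Proof.
rewrite eq_sym -hdist_gt0 => /sinh_gt0/lt0r_neq0 s0.
by rewrite /dir sqnorm2_scale2 sqnorm2_frame exprVn mulVf// expf_neq0.
Qed.

Lemma frame_polar P t v : sqnorm2 v = 1 ->
  frame P (polar P t v) = (cosh t, scale2 (sinh t) v).
Proof.
move=> v1; set y := (cosh t, _).
have yy : mink y y = 1.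
  have -> : mink y y = cosh t ^+ 2 - sinh t ^+ 2 * sqnorm2 v.
    by rewrite /mink /dot2 /sqnorm2 /=; ring.
  by rewrite v1 mulr1 cosh_sinh2.
have y0 : 0 < y.1 by rewrite (lt_le_trans _ (cosh_ge1 t)).
have by0 : 0 < (boost P y).1 by rewrite boost_gt0 ?hval_lt1 ?yy.
have byy : mink (boost P y) (boost P y) = 1 by rewrite mink_boost ?hval_lt1.
rewrite /polar /frame -/y insubdK; last exact: stereo_lt1.
by rewrite stereoK// boostK// hval_lt1.
Qed.

Lemma cosh_polar P s t v w : sqnorm2 v = 1 -> sqnorm2 w = 1 ->
  cosh (hdist (polar P s v) (polar P t w)) =
  cosh s * cosh t - sinh s * sinh t * dot2 v w.
Proof.
by move=> v1 w1; rewrite -(mink_frame P) !frame_polar// /mink /dot2 /=; ring.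
Qed.

(** The hyperbolic law of cosines; [dot2] of the directions is the cosine of the angle at [P]. *)
Lemma cosh_hdist_dir P x y : x != P -> y != P ->
  cosh (hdist x y) = cosh (hdist P x) * cosh (hdist P y)
    - sinh (hdist P x) * sinh (hdist P y) * dot2 (dir P x) (dir P y).
Proof.
by move=> xP yP; rewrite -(mink_frame P) !frame_dir// /mink /dot2 /=; ring.
Qed.

Lemma polar_dir P x : x != P -> polar P (hdist P x) (dir P x) = x.
Proof.
by move=> xP; apply: (@frame_inj P); rewrite frame_polar ?dir_unit// -frame_dir.
Qed.

Lemma polar0 P v : sqnorm2 v = 1 -> polar P 0 v = P.
Proof.
move=> v1; apply: (@frame_inj P); rewrite frame_polar// framexx cosh0 sinh0.
by rewrite /scale2 !mul0r.
Qed.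

Lemma dot2_unit v : sqnorm2 v = 1 -> dot2 v v = 1.
Proof. by rewrite /dot2 -!expr2. Qed.

Lemma hdist_polar P s t v : sqnorm2 v = 1 ->
  hdist (polar P s v) (polar P t v) = `|s - t|.
Proof.
move=> v1; rewrite -[LHS]coshK ?hdist_ge0// cosh_polar// dot2_unit// mulr1.
by rewrite -coshB -cosh_norm coshK.
Qed.

Lemma hdist_polar0 P t v : sqnorm2 v = 1 -> 0 <= t -> hdist P (polar P t v) = t.
Proof.
move=> v1 t0; rewrite -{1}(polar0 P v1) hdist_polar// sub0r normrN.
by rewrite ger0_norm.
Qed.

Lemma dir_polar P t v : sqnorm2 v = 1 -> 0 < t -> dir P (polar P t v) = v.
Proof.
move=> v1 t0; rewrite /dir hdist_polar0 ?ltW// frame_polar//.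
have /lt0r_neq0 s0 := sinh_gt0 t0.
by rewrite -{2}(invrK (sinh t)) scale2K// invr_neq0.
Qed.

Lemma unit_eq v w : sqnorm2 v = 1 -> sqnorm2 w = 1 -> dot2 v w = 1 -> v = w.
Proof.
case: v w => [v1 v2] [w1 w2]; rewrite /sqnorm2 /dot2 /= => v11 w11 vw.
have : (v1 - w1) ^+ 2 + (v2 - w2) ^+ 2 = 0 by nra.
move/eqP; rewrite paddr_eq0 ?sqr_ge0// !sqrf_eq0 !subr_eq0.
by case/andP => /eqP -> /eqP ->.
Qed.

(* Equality in the triangle inequality makes the angle at [P] vanish. *)
Lemma geodesic_polar P L (c : R -> hplane R) : 0 < L -> c 0 = P ->
  geodesic_on `[0, L]%classic c ->
  forall t, 0 <= t <= L -> c t = polar P t (dir P (c L)).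
Proof.
move=> L0 c0 geo t /andP[t0 tL].
have dP r : 0 <= r <= L -> hdist P (c r) = r.
  move=> /andP[r0 rL]; rewrite -c0 -[LHS]/(mdist (c 0) (c r)).
  rewrite geo /= ?in_itv/= ?lexx ?r0 ?(ltW L0)//.
  by rewrite sub0r normrN ger0_norm.
have cP r : 0 < r <= L -> c r != P.
  by move=> /andP[r0 rL]; rewrite eq_sym -hdist_gt0 dP// rL ltW.
have LL : 0 < L <= L by rewrite L0 lexx.
move: t0; rewrite le_eqVlt => /predU1P[<-|t0].
  by rewrite polar0 ?c0// dir_unit// cP.
have t0L : 0 < t <= L by rewrite t0.
have t0L' : 0 <= t <= L by rewrite (ltW t0).
have LL' : 0 <= L <= L by rewrite (ltW L0) lexx.
rewrite -{1}(polar_dir (cP _ t0L)) dP//; congr polar.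
apply: unit_eq; rewrite ?dir_unit ?cP//.
have := cosh_hdist_dir (cP _ t0L) (cP _ LL).
have -> : hdist (c t) (c L) = `|t - L| by apply: geo; rewrite /= in_itv.
rewrite cosh_norm coshB !dP// => /addrI/oppr_inj/esym.
rewrite -[RHS]mulr1; apply: mulfI.
by rewrite mulf_neq0// lt0r_neq0// sinh_gt0.
Qed.

End PolarCoordinates.

(** * Endpoints of rays and the cyclic order at a point *)

Section EndpointsAtInfinity.
Context {R : realType}.
Implicit Types (v w : R * R) (P x y z : hplane R) (r t : R).

(** The endpoint of the ray from [P] in direction [v]: the boosted null vector (1, v), rescaled to
    first coordinate 1. *)
Definition bd P v : R * R :=
  let n := boost P (1, v) in (n.2.1 / n.1, n.2.2 / n.1).

Lemma cvg_rational (a0 a1 b0 b1 : R) : b0 != 0 ->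
  ((a0 + r ^+ 2 * a1) / (2 * r + b0 + r ^+ 2 * b1))
     @[r --> (0 : R)] --> a0 / b0.
Proof.
move=> b00.
have r2 : r ^+ 2 @[r --> (0 : R)] --> (0 : R).
  by rewrite -[X in _ --> X](expr0n R 2); exact: exprn_continuous.
apply: cvgM; last apply: cvgV => //.
  rewrite -[X in _ --> X]addr0 -[X in _ --> _ + X](mul0r a1).
  by apply: cvgD; [exact: cvg_cst|apply: cvgMl].
rewrite -[X in _ --> X]addr0 -[X in _ --> _ + X](mul0r b1).
apply: cvgD; last exact: cvgMl.
rewrite -[X in _ --> X]add0r -[X in _ --> X + _](mulr0 2).
by apply: cvgD; [apply: cvgMr; exact: cvg_id|exact: cvg_cst].
Qed.

Lemma boost1_gt0 P v : sqnorm2 v = 1 -> 0 < (boost P (1, v)).1.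
Proof.
move=> v1; apply: boost_gt0; rewrite ?hval_lt1//.
by rewrite /mink dot2_unit//= mulr1 subrr.
Qed.

Lemma hval_polar P t v : sqnorm2 v = 1 ->
  hval (polar P t v) = stereo (boost P (cosh t, scale2 (sinh t) v)).
Proof.
move=> v1; rewrite -[LHS](liftK (hval_lt1 _)).
by rewrite -[lift _](boostNK (hval_lt1 P)) -/(frame _ _) frame_polar.
Qed.

(* With [r = expR (- t)], the point at distance [t] is a rational function of
   [r] that is continuous at [r = 0]. *)
Lemma cvg_polar P v : sqnorm2 v = 1 ->
  hval (polar P t v) @[t --> +oo] --> bd P v.
Proof.
move=> v1; have n0 := lt0r_neq0 (boost1_gt0 P v1).
have e0 := @cvgr_expR R.
have E t : boost P (cosh t, scale2 (sinh t) v) =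
   let n := boost P (1, v) in let m := boost P (1, - v) in
   let r := expR (- t) in
   ((n.1 + r ^+ 2 * m.1) / (2 * r),
    ((n.2.1 + r ^+ 2 * m.2.1) / (2 * r), (n.2.2 + r ^+ 2 * m.2.2) / (2 * r))).
  rewrite /cosh /sinh expRN /boost /scale2 /dot2 /=.
  have n1 : 1 - sqnorm2 P != 0 by rewrite gt_eqF// subr_gt0 hval_lt1.
  have et : expR t != 0 by rewrite gt_eqF ?expR_gt0.
  by congr (_, (_, _)); field; rewrite n1 et.
have lim (a0 a1 : R) : let n := boost P (1, v) in let m := boost P (1, - v) in
    ((a0 + expR (- t) ^+ 2 * a1) / (2 * expR (- t) + n.1 + expR (- t) ^+ 2 * m.1))
      @[t --> +oo] --> a0 / n.1.
  move=> n m.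
  have := @cvg_rational a0 a1 n.1 m.1 n0.
  exact: (@cvg_comp _ _ _ (fun t => expR (- t)) _ _ _ _ e0).
have m0 : 0 < (boost P (1, - v)).1 by rewrite boost1_gt0// sqnorm2N.
rewrite (_ : (fun t => _) = fun t => let n := boost P (1, v) in
    let m := boost P (1, - v) in let r := expR (- t) in
    ((n.2.1 + r ^+ 2 * m.2.1) / (2 * r + n.1 + r ^+ 2 * m.1),
     (n.2.2 + r ^+ 2 * m.2.2) / (2 * r + n.1 + r ^+ 2 * m.1))).
  exact: (cvg_pair (lim _ _) (lim _ _)).
apply/funext => t; rewrite hval_polar// E /stereo.
move: (boost1_gt0 P v1) m0 (expR_gt0 (- t)).
move: (boost P (1, v)) (boost P (1, - v)) (expR (- t)).
move=> [a [a1 a2]] [b [b1 b2]] r /= a0 b0 r0.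
have d0 : 0 < 2 * r + a + r ^+ 2 * b.
  by rewrite !addr_gt0// mulr_gt0// exprn_gt0.
by congr (_, _); field; rewrite !gt_eqF//=; lra.
Qed.

(** Homogeneous coordinates turn the affine orientation into a linear determinant, on which boosts
    act trivially. *)
Lemma circle_order_det3 v1 v2 v3 :
  circle_order v1 v2 v3 = sgz (det3 (1, v1) (1, v2) (1, v3)).
Proof. by rewrite /circle_order /det3 /det2 /=; congr sgz; ring. Qed.

(** Boosts preserve [det3], and dividing each vector by its positive first coordinate keeps the
    sign. Hence the order of the endpoints is the order of the directions at [P]. *)
Lemma circle_order_bd P v1 v2 v3 :
  sqnorm2 v1 = 1 -> sqnorm2 v2 = 1 -> sqnorm2 v3 = 1 ->
  circle_order (bd P v1) (bd P v2) (bd P v3) = circle_order v1 v2 v3.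
Proof.
move=> u1 u2 u3; rewrite !circle_order_det3 -[in RHS](det3_boost _ _ _ (hval_lt1 P)).
have := boost1_gt0 P u1; have := boost1_gt0 P u2; have := boost1_gt0 P u3.
rewrite /bd.
move: (boost _ (1, v1)) (boost _ (1, v2)) (boost _ (1, v3)).
move=> [a [a1 a2]] [b [b1 b2]] [c [c1 c2]] /= c0 b0 a0.
have -> : det3 (a, (a1, a2)) (b, (b1, b2)) (c, (c1, c2)) =
    a * b * c * det3 (1, (a1 / a, a2 / a)) (1, (b1 / b, b2 / b)) (1, (c1 / c, c2 / c)).
  by rewrite /det3 /det2 /=; field; rewrite !gt_eqF.
by rewrite sgzM (@gtr0_sgz _ (a * b * c)) ?mul1r// !mulr_gt0.
Qed.

Lemma represents_agree P x (g : germ P) : represents x g ->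
  exists2 c : segment P, segment_end c = x & agree_near0 (repr g) c.
Proof.
move=> [c cx ->]; exists c => //; apply/asboolP.
by rewrite -/(germ_rel _ _) -[germ_rel _ _](eqmodE (germ_rel_equiv P)) reprK.
Qed.

(** The polar ray through [x] meets the specification. Any other ray with this germ shares a point
    other than [P] with it, hence coincides with it from there on and has the same limit. *)
Lemma germ_endpointE P x (g : germ P) : represents x g ->
  germ_endpoint g = bd P (dir P x).
Proof.
move=> xg; have xP := represents_neq xg; have u := dir_unit xP.
have [c cx gc] := represents_agree xg.
have L0 := segment_length_gt0 c.
have cE := geodesic_polar L0 (segment_fun0 c) (@segment_geodesic _ _ _ c).
rewrite -/(segment_end c) cx in cE.
apply: xget_subset1.
  exists (fun t => polar P t (dir P x)); split.
  - exact: polar0.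
  - by move=> s t _ _; exact: hdist_polar.
  - have [e e0 gce] := gc.
    exists (Num.min e (segment_length c)); first by rewrite lt_min e0.
    move=> t /andP[t0]; rewrite lt_min => /andP[te tL].
    by rewrite gce ?t0// cE// t0 ltW.
  - exact: cvg_polar.
have U xi : germ_endpoint_spec g xi -> xi = bd P (dir P x).
  move=> [c' [c'0 c'geo [f f0 gc'] c'xi]].
  have [e e0 gce] := gc.
  (* Halving keeps [s] positive and strictly inside the half-open intervals of agreement. *)
  pose s := Num.min (Num.min e f) (segment_length c) / 2.
  have m0 : 0 < Num.min (Num.min e f) (segment_length c).
    by rewrite !lt_min e0 f0.
  have s0 : 0 < s by rewrite divr_gt0.
  have : s < Num.min (Num.min e f) (segment_length c) by rewrite /s; lra.
  rewrite !lt_min => /andP[/andP[se sf] sL].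
  have c's : c' s = polar P s (dir P x).
    by rewrite -gc' ?gce ?cE ?ltW ?se ?sf.
  (* On [0, T] the ray is polar with direction towards [c' T]; comparing at [s] identifies this
     direction with that of [x]. *)
  have c'E T : s <= T -> c' T = polar P T (dir P x).
    move=> sT; have T0 : 0 < T by exact: lt_le_trans sT.
    have c'T : forall t, 0 <= t <= T -> c' t = polar P t (dir P (c' T)).
      apply: geodesic_polar => // a b; rewrite /= !in_itv/=.
      by move=> /andP[a0 _] /andP[b0 _]; apply: c'geo; rewrite /= in_itv/= ?a0 ?b0.
    have c'TP : c' T != P.
      rewrite eq_sym -hdist_gt0 -c'0.
      by rewrite -[hdist _ _]/(mdist (c' 0) (c' T)) c'geo ?sub0r ?normrN ?gtr0_norm //=
        in_itv/= ?lexx ?ltW.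
    have := c'T s; rewrite sT (ltW s0) c's => /(_ isT) ps.
    have := dir_polar P u s0; rewrite ps dir_polar ?dir_unit// => <-.
    by rewrite -c'T// lexx ltW.
  apply: (@cvg_unique _ _ _ _ _ _ c'xi); first exact: norm_hausdorff.
  apply: (@cvg_trans _ (hval (polar P T (dir P x)) @[T --> +oo])).
    by apply: near_eq_cvg; near=> T; rewrite /= c'E.
  exact: cvg_polar.
by move=> a b /U -> /U ->.
Unshelve. all: by end_near. Qed.

Lemma represents_ex P x : x != P -> exists g : germ P, represents x g.
Proof.
move=> xP; have u := dir_unit xP.
have d0 : 0 < hdist P x by rewrite hdist_gt0 eq_sym.
have g : geodesic_on `[0, hdist P x]%classic (fun t => polar P t (dir P x)).
  by move=> s t _ _; exact: hdist_polar.
pose c : segment P := @Segment R (hplane R) P _ _ d0 (polar0 P u) g.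
exists (\pi_(germ P) c); exists c => //.
exact: polar_dir.
Qed.

(** All germs represented by the three points yield the same value, so the choice made in
    [hor_point] is harmless and or(P) becomes a sign of directions. *)
Lemma hor_pointE P x y z : x != P -> y != P -> z != P ->
  hor_point P x y z = circle_order (dir P x) (dir P y) (dir P z).
Proof.
move=> xP yP zP.
have H (n : int) : (exists a b c : germ P,
    [/\ represents x a, represents y b, represents z c & n = hor a b c]) ->
    n = circle_order (dir P x) (dir P y) (dir P z).
  move=> [a [b [c [xa yb zc ->]]]].
  rewrite /hor (germ_endpointE xa) (germ_endpointE yb) (germ_endpointE zc).
  by rewrite circle_order_bd ?dir_unit.
apply: xget_subset1; last by move=> m n /H -> /H ->.
have [a xa] := represents_ex xP; have [b yb] := represents_ex yP.
have [c zc] := represents_ex zP.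
exists a, b, c; split => //.
by apply/esym/H; exists a, b, c.
Qed.

End EndpointsAtInfinity.

(** * The cyclic order on the circle and its stability *)

Section CircleOrder.
Context {R : realType}.
Implicit Types (a b c : R * R) (x y z : R * (R * R)).

Lemma circle_order_rot a b c : circle_order a b c = circle_order b c a.
Proof. by rewrite /circle_order /det2 /=; congr sgz; ring. Qed.

Lemma circle_order_swap a b c : circle_order a c b = - circle_order a b c.
Proof. by rewrite /circle_order /det2 /= -sgzN; congr sgz; ring. Qed.

Lemma circle_order_range a b c : circle_order a b c \in [:: -1; 0; 1].
Proof.
by rewrite /circle_order; case: sgzP.
Qed.

(** The Gram determinant of the Minkowski form; diag(1, -1, -1) has determinant 1, so it equals the
    square without a sign. *)
Lemma det3_gram x y z : det3 x y z ^+ 2 =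
  mink x x * (mink y y * mink z z - mink y z ^+ 2)
  - mink x y * (mink x y * mink z z - mink y z * mink x z)
  + mink x z * (mink x y * mink y z - mink y y * mink x z).
Proof. by rewrite /det3 /mink /dot2 /det2; ring. Qed.

Definition sep a b : R := 1 - dot2 a b.

Lemma sepC a b : sep a b = sep b a.
Proof. by rewrite /sep /dot2 mulrC [_.2 * _]mulrC. Qed.

(** The vectors (1, v) are null, so the diagonal of the Gram matrix vanishes and only twice the
    product of the off-diagonal entries remains. *)
Lemma det3_unit a b c : sqnorm2 a = 1 -> sqnorm2 b = 1 -> sqnorm2 c = 1 ->
  det3 (1, a) (1, b) (1, c) ^+ 2 = 2 * (sep a b * sep b c * sep c a).
Proof.
move=> ua ub uc; rewrite det3_gram.
have null v : sqnorm2 v = 1 -> mink (1, v) (1, v) = 0.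
  by move=> v1; rewrite /mink dot2_unit//= mulr1 subrr.
rewrite !null// (sepC c) /mink /sep /=; ring.
Qed.

Lemma sgz_perturb (d e : R) : (d - e) ^+ 2 < d ^+ 2 -> sgz e = sgz d.
Proof.
move=> de; have [d0|d0|d0] := ltgtP d 0; last by exfalso; move: de; rewrite d0; nra.
- by rewrite !ltr0_sgz//; nra.
- by rewrite !gtr0_sgz//; nra.
Qed.

Lemma sqnorm2_unitB a b : sqnorm2 a = 1 -> sqnorm2 b = 1 ->
  sqnorm2 (a - b) = 2 * sep a b.
Proof. by rewrite /sqnorm2 /sep /dot2 /=; lra. Qed.

Lemma sep_le2 a b : sqnorm2 a = 1 -> sqnorm2 b = 1 -> sep a b <= 2.
Proof.
move=> ua ub; have := sqnorm2_ge0 (a + b); move: ua ub.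
by rewrite /sep /dot2 /sqnorm2 /=; lra.
Qed.

Lemma sep_ge0 a b : sqnorm2 a = 1 -> sqnorm2 b = 1 -> 0 <= sep a b.
Proof.
by move=> ua ub; have := sqnorm2_ge0 (a - b); rewrite sqnorm2_unitB//; lra.
Qed.

(** The two determinants differ by [det2 (a - a') (b - c)], whose square is at most 4 [sep a a']
    [sep b c], hence at most 8 [sep a a']. The squared determinant is twice the product on the
    right. *)
Lemma circle_order_perturb a a' b c :
  sqnorm2 a = 1 -> sqnorm2 a' = 1 -> sqnorm2 b = 1 -> sqnorm2 c = 1 ->
  4 * sep a a' < sep a b * sep b c * sep c a ->
  circle_order a' b c = circle_order a b c.
Proof.
move=> ua ua' ub uc h; rewrite !circle_order_det3; apply: sgz_perturb.
rewrite [ltRHS]det3_unit//.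
have -> : det3 (1, a) (1, b) (1, c) - det3 (1, a') (1, b) (1, c) =
    det2 (a - a') (b - c) by rewrite /det3 /det2 /=; ring.
apply: (@le_lt_trans _ _ (sqnorm2 (a - a') * sqnorm2 (b - c))).
  by rewrite -dot2_sqr lerDr sqr_ge0.
rewrite !sqnorm2_unitB//.
have := sep_le2 ub uc; rewrite -subr_ge0 => /(mulr_ge0 (sep_ge0 ua ua')).
by move: (sep a a') (sep b c) (sep a b) (sep c a) h => s t p q; lra.
Qed.

Lemma circle_order_neq0 a b c :
  sqnorm2 a = 1 -> sqnorm2 b = 1 -> sqnorm2 c = 1 ->
  0 < sep a b * sep b c * sep c a -> circle_order a b c != 0.
Proof.
move=> ua ub uc h; rewrite circle_order_det3 sgz_eq0 -sqrf_eq0 det3_unit//.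
by rewrite mulf_neq0// gt_eqF.
Qed.

Lemma circle_order_trans a b c d :
  sqnorm2 a = 1 -> sqnorm2 b = 1 -> sqnorm2 c = 1 -> sqnorm2 d = 1 ->
  circle_order a b c = 1 -> circle_order a c d = 1 -> circle_order a b d = 1.
Proof.
move=> ua ub uc ud; rewrite !circle_order_det3 => /eqP; rewrite sgz_cp0 => abc.
move=> /eqP; rewrite sgz_cp0 => acd; apply/eqP; rewrite sgz_cp0.
have sep_gt0 v w r : sqnorm2 v = 1 -> sqnorm2 w = 1 -> sqnorm2 r = 1 ->
    0 < det3 (1, v) (1, w) (1, r) -> 0 < sep v w /\ 0 < sep r v.
  move=> uv uw ur /(exprn_gt0 2); rewrite det3_unit// => h.
  by split; rewrite lt0r sep_ge0// andbT; apply/eqP => s0;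
    move: h; rewrite s0 ?(mulr0, mul0r) ltxx.
have [ab ca] := sep_gt0 _ _ _ ua ub uc abc.
have [_ da] := sep_gt0 _ _ _ ua uc ud acd.
rewrite -(pmulr_lgt0 _ ca).
(* Four vectors of R^3 satisfy a linear relation whose coefficients are their 3 by 3 determinants.
   Pairing it with the null vector (1, a) removes one term and leaves this identity. *)
have -> : det3 (1, a) (1, b) (1, d) * sep c a =
    det3 (1, a) (1, b) (1, c) * sep d a + det3 (1, a) (1, c) (1, d) * sep a b.
  by rewrite /sep -ua /det3 /det2 /dot2 /sqnorm2 /=; ring.
by rewrite addr_gt0// mulr_gt0.
Qed.

(** Replacing the three first coordinates by 1 changes the determinant by at most 3 e, because each
    cofactor is a [det2] of unit vectors. *)
Lemma det3_perturb (e : R) x y z :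
  sqnorm2 x.2 = 1 -> sqnorm2 y.2 = 1 -> sqnorm2 z.2 = 1 ->
  `|x.1 - 1| <= e -> `|y.1 - 1| <= e -> `|z.1 - 1| <= e ->
  9 * e ^+ 2 < 2 * (sep x.2 y.2 * sep y.2 z.2 * sep z.2 x.2) ->
  sgz (det3 x y z) = circle_order x.2 y.2 z.2.
Proof.
case: x y z => [x a] [y b] [z c] /= ua ub uc xe ye ze h.
rewrite circle_order_det3; apply: sgz_perturb; rewrite det3_unit//.
apply: le_lt_trans h.
have -> : det3 (1, a) (1, b) (1, c) - det3 (x, a) (y, b) (z, c) =
    - ((x - 1) * det2 b c + (y - 1) * det2 c a + (z - 1) * det2 a b).
  by rewrite /det3 /det2 /=; ring.
have d1 v w : sqnorm2 v = 1 -> sqnorm2 w = 1 -> `|det2 v w| <= 1.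
  move=> uv uw; rewrite -(@expr_le1 _ 2)// real_normK ?num_real//.
  by have := dot2_sqr v w; rewrite uv uw mulr1 => <-; rewrite lerDr sqr_ge0.
have e0 : 0 <= e by exact: le_trans xe.
rewrite sqrrN -real_normK ?num_real// (_ : 9 * e ^+ 2 = (e + e + e) ^+ 2); last ring.
rewrite ler_sqr ?nnegrE ?addr_ge0//.
rewrite (le_trans (ler_normD _ _))// lerD// ?(le_trans (ler_normD _ _))// ?lerD//.
all: by rewrite normrM -[leRHS]mulr1 ler_pM// d1.
Qed.

End CircleOrder.

(** * Distance and angle estimates in the hyperbolic plane *)

Section Estimates.
Context {R : realType}.
Implicit Types (P x y z w : hplane R).

(** In complex notation put A = (x - z)(y - w) and B = (x - w)(y - z). Then (x - y)(z - w) = A - B,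
    and the difference of the two sides is a positive multiple of 2 |A|^2 + 2 |B|^2 - |A - B|^2 = |A
    + B|^2. *)
Lemma ptolemy x y z w :
  (hcosh_dist x y - 1) * (hcosh_dist z w - 1) <=
  2 * ((hcosh_dist x z - 1) * (hcosh_dist y w - 1) +
       (hcosh_dist x w - 1) * (hcosh_dist y z - 1)).
Proof.
rewrite /hcosh_dist !(addrC 1) !addrK.
have := hval_lt1 x; have := hval_lt1 y; have := hval_lt1 z; have := hval_lt1 w.
rewrite -!(subr_gt0 _ 1) /sqnorm2 /=.
case: (hval x) (hval y) (hval z) (hval w) => [x1 x2] [y1 y2] [z1 z2] [w1 w2] /=.
move=> w0 z0 y0 x0; rewrite -subr_ge0.
set l := (X in 0 <= X).
suff -> : l = 4 *
   ((((x1 - z1) * (y1 - w1) - (x2 - z2) * (y2 - w2)) +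
     ((x1 - w1) * (y1 - z1) - (x2 - w2) * (y2 - z2))) ^+ 2
  + (((x1 - z1) * (y2 - w2) + (x2 - z2) * (y1 - w1)) +
     ((x1 - w1) * (y2 - z2) + (x2 - w2) * (y1 - z1))) ^+ 2)
  / ((1 - (x1 ^+ 2 + x2 ^+ 2)) * (1 - (y1 ^+ 2 + y2 ^+ 2))
    * ((1 - (z1 ^+ 2 + z2 ^+ 2)) * (1 - (w1 ^+ 2 + w2 ^+ 2)))).
  apply: divr_ge0; first by rewrite mulr_ge0// addr_ge0// sqr_ge0.
  by apply/ltW; rewrite !mulr_gt0.
by rewrite /l; field; rewrite !gt_eqF.
Qed.

Lemma sinh_le_expR (t : R) : sinh t <= expR t / 2.
Proof. by rewrite /sinh ler_pM2r// gerBl expR_ge0. Qed.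

Lemma cosh_ge_expR (t : R) : expR t / 2 <= cosh t.
Proof. by rewrite /cosh ler_pM2r// lerDl expR_ge0. Qed.

Lemma cosh_le_expR (t : R) : cosh t <= expR `|t|.
Proof.
rewrite -cosh_norm /cosh.
have : expR (- `|t|) <= expR `|t| by rewrite ler_expR ge0_cp.
by lra.
Qed.

Lemma sinh_ge_expR (t : R) : 1 <= t -> expR t / 4 <= sinh t.
Proof.
move=> t1; rewrite /sinh.
have := expR_ge1Dx t; have := expRxMexpNx_1 t; have := expR_gt0 (- t).
by move: (expR t) (expR (- t)) => E N; nra.
Qed.

Lemma expRBD (s t r : R) : expR (s - t - r) * (expR t * expR r) = expR s.
Proof. by rewrite -!expRD; congr expR; ring. Qed.

(** For d >= 3 one has exp(d) >= 4, so cosh d - 1 lies between exp(d) / 4 and exp(d). Inserted into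
    [ptolemy] this costs a factor 4 * 4 * 4 = 64. *)
Lemma four_point x y z w : 3 <= hdist x y -> 3 <= hdist z w ->
  hdist x y + hdist z w <=
  Num.max (hdist x z + hdist y w) (hdist x w + hdist y z) + 63.
Proof.
move=> xy zw; set m := Num.max _ _.
have lo (p q : hplane R) : 3 <= hdist p q -> expR (hdist p q) / 4 <= hcosh_dist p q - 1.
  move=> pq; rewrite -cosh_hdist; have := cosh_ge_expR (hdist p q).
  by have := expR_ge1Dx (hdist p q); lra.
have hi (p q : hplane R) : 0 <= hcosh_dist p q - 1 <= expR (hdist p q).
  rewrite subr_ge0 hcosh_dist_ge1 /= -cosh_hdist.
  by have := cosh_le_expR (hdist p q); rewrite ger0_norm ?hdist_ge0//; lra.
have hi2 (p q r s : hplane R) : hdist p q + hdist r s <= m ->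
    (hcosh_dist p q - 1) * (hcosh_dist r s - 1) <= expR m.
  move=> le; have /andP[p0 p1] := hi p q; have /andP[r0 r1] := hi r s.
  by rewrite (le_trans (ler_pM p0 r0 p1 r1))// -expRD ler_expR.
have h1 : (hcosh_dist x z - 1) * (hcosh_dist y w - 1) <= expR m.
  by apply: hi2; rewrite le_max lexx.
have h2 : (hcosh_dist x w - 1) * (hcosh_dist y z - 1) <= expR m.
  by apply: hi2; rewrite le_max lexx orbT.
have := ptolemy x y z w.
have e0 (p q : hplane R) : 0 <= expR (hdist p q) / 4 by rewrite divr_ge0// expR_ge0.
have := ler_pM (e0 x y) (e0 z w) (lo _ _ xy) (lo _ _ zw).
move=> l1 l2.
have : expR (hdist x y + hdist z w) <= 64 * expR m by rewrite expRD; lra.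
(* The additive constant 63 is a crude bound for ln 64, coming from 1 + t <= exp(t). *)
have e63 : 64 <= expR (63 : R) by have := expR_ge1Dx (63 : R); lra.
move=> l3; rewrite -ler_expR (le_trans l3)// [leRHS]expRD [leRHS]mulrC.
by rewrite ler_pM2r ?expR_gt0.
Qed.

Lemma sep_dir P x y : x != P -> y != P -> sep (dir P x) (dir P y) =
  (cosh (hdist x y) - cosh (hdist P x - hdist P y)) /
  (sinh (hdist P x) * sinh (hdist P y)).
Proof.
move=> xP yP; rewrite (cosh_hdist_dir xP yP) coshB /sep.
move: xP yP; rewrite !(eq_sym _ P) -!hdist_gt0 => /sinh_gt0 x0 /sinh_gt0 y0.
have := lt0r_neq0 x0; have := lt0r_neq0 y0.
by move: (cosh _) (cosh _) (sinh _) (sinh _) (dot2 _ _) => *; field; apply/andP.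
Qed.

(** The margin 3 makes the subtracted cosh at most exp(d(x, y)) / 4, so the numerator in [sep_dir]
    is at least exp(d(x, y)) / 4. Each sinh in the denominator is at most half an exponential. *)
Lemma sep_dir_ge P x y : x != P -> y != P ->
  `|hdist P x - hdist P y| + 3 <= hdist x y ->
  expR (hdist x y - hdist P x - hdist P y) <= sep (dir P x) (dir P y).
Proof.
move=> xP yP h; rewrite sep_dir//.
move: xP yP; rewrite !(eq_sym _ P) -!hdist_gt0 => x0 y0.
have sx := sinh_gt0 x0; have sy := sinh_gt0 y0.
rewrite ler_pdivlMr ?(mulr_gt0 sx sy)//.
have num : expR (hdist x y) / 4 <=
    cosh (hdist x y) - cosh (hdist P x - hdist P y).
  have := cosh_le_expR (hdist P x - hdist P y).
  have := cosh_ge_expR (hdist x y).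
  have : expR `|hdist P x - hdist P y| * expR 3 <= expR (hdist x y).
    by rewrite -expRD ler_expR.
  have := expR_ge1Dx (3 : R); have := expR_gt0 `|hdist P x - hdist P y|.
  by nra.
apply: le_trans num.
rewrite -(expRBD (hdist x y) (hdist P x) (hdist P y)) -[leRHS]mulrA.
rewrite ler_pM2l ?expR_gt0//.
have -> : expR (hdist P x) * expR (hdist P y) / 4 =
  expR (hdist P x) / 2 * (expR (hdist P y) / 2) by field.
by apply: (ler_pM (ltW sx) (ltW sy)); exact: sinh_le_expR.
Qed.

Lemma sep_dir_le P x y : 1 <= hdist P x -> 1 <= hdist P y ->
  sep (dir P x) (dir P y) <= 16 * expR (hdist x y - hdist P x - hdist P y).
Proof.
move=> x1 y1; have x0 : 0 < hdist P x by lra.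
have y0 : 0 < hdist P y by lra.
rewrite sep_dir; try by rewrite eq_sym -hdist_gt0.
have sx := sinh_gt0 x0; have sy := sinh_gt0 y0.
rewrite ler_pdivrMr ?(mulr_gt0 sx sy)//.
apply: (@le_trans _ _ (expR (hdist x y))).
  have := cosh_le_expR (hdist x y); rewrite ger0_norm ?hdist_ge0//.
  by have := cosh_ge1 (hdist P x - hdist P y); lra.
rewrite -(expRBD (hdist x y) (hdist P x) (hdist P y)) (mulrC 16) -[leRHS]mulrA.
rewrite ler_pM2l ?expR_gt0//.
have -> : expR (hdist P x) * expR (hdist P y) =
  16 * (expR (hdist P x) / 4 * (expR (hdist P y) / 4)) by field.
by rewrite ler_pM2l//; apply: ler_pM; rewrite ?sinh_ge_expR// divr_ge0 ?expR_ge0.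
Qed.

(** A point at distance t in direction v, divided by sinh t, is (coth t, v); this bounds how far it
    is from the null vector (1, v). *)
Lemma coth_le (t : R) : 1 <= t -> `|cosh t / sinh t - 1| <= 4 * expR (- (2 * t)).
Proof.
move=> t1; have s0 : 0 < sinh t by apply: sinh_gt0; exact: lt_le_trans t1.
have -> : cosh t / sinh t - 1 = expR (- t) / sinh t.
  rewrite -[X in _ - X](divff (lt0r_neq0 s0)) -mulrBl; congr (_ / _).
  by rewrite /cosh /sinh; field.
rewrite ger0_norm; last by rewrite divr_ge0 ?expR_ge0// ltW.
rewrite ler_pdivrMr// (_ : - (2 * t) = - t + - t) ?expRD; last by ring.
have := sinh_ge_expR t1; rewrite -subr_ge0.
move/(mulr_ge0 (mulr_ge0 (expR_ge0 (- t)) (expR_ge0 (- t)))).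
have := expRxMexpNx_1 t; move: (expR t) (expR (- t)) (sinh t) => E N S EN.
have : N * N * E = N by rewrite -mulrA (mulrC N E) EN mulr1.
by clear; lra.
Qed.

Lemma det3_scale2 (c1 c2 c3 s1 s2 s3 : R) (a b c : R * R) :
  s1 != 0 -> s2 != 0 -> s3 != 0 ->
  det3 (c1, scale2 s1 a) (c2, scale2 s2 b) (c3, scale2 s3 c) =
  s1 * s2 * s3 * det3 (c1 / s1, a) (c2 / s2, b) (c3 / s3, c).
Proof.
by rewrite /det3 /det2 /scale2 /= => *; field; apply/and3P.
Qed.

(** Boosting [P] to the apex preserves the determinant, and dividing by the three positive sinh
    factors preserves its sign. What remains is a perturbation of the determinant of the null
    vectors of the directions. *)
Lemma orientation_dir (e : R) P x y z :
  1 <= hdist P x -> 1 <= hdist P y -> 1 <= hdist P z ->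
  4 * expR (- (2 * hdist P x)) <= e -> 4 * expR (- (2 * hdist P y)) <= e ->
  4 * expR (- (2 * hdist P z)) <= e ->
  9 * e ^+ 2 < 2 * (sep (dir P x) (dir P y) * sep (dir P y) (dir P z)
                    * sep (dir P z) (dir P x)) ->
  sgz (det3 (lift (hval x)) (lift (hval y)) (lift (hval z))) =
  circle_order (dir P x) (dir P y) (dir P z).
Proof.
move=> x1 y1 z1 xe ye ze h.
have pos w : 1 <= hdist P w -> 0 < hdist P w by exact: lt_le_trans.
have neq w : 1 <= hdist P w -> w != P.
  by move=> w1; rewrite eq_sym -hdist_gt0 pos.
have sx := sinh_gt0 (pos _ x1); have sy := sinh_gt0 (pos _ y1).
have sz := sinh_gt0 (pos _ z1).
have Pn : sqnorm2 (- hval P) < 1 by rewrite sqnorm2N hval_lt1.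
rewrite -(det3_boost _ _ _ Pn) -!/(frame _ _) !frame_dir ?neq//.
rewrite (det3_scale2 _ _ _ _ _ _ (lt0r_neq0 sx) (lt0r_neq0 sy) (lt0r_neq0 sz)).
rewrite sgzM gtr0_sgz; last first.
  exact: mulr_gt0 (mulr_gt0 sx sy) sz.
rewrite mul1r (det3_perturb (e := e)) ?dir_unit ?neq//.
- exact: le_trans (coth_le x1) xe.
- exact: le_trans (coth_le y1) ye.
- exact: le_trans (coth_le z1) ze.
Qed.

End Estimates.

(** * Limits of integer sequences along an ultrafilter *)

Section Ulim.
Context (u : set_system nat) (uU : UltraFilter u).

Lemma ulimE (f : nat -> int) (n : int) :
  (\forall k \near u, f k = n) -> ulim u f = n.
Proof.
move=> fn; apply: xget_subset1 => // m p fm fp.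
by have [k [<- <-]] := filter_ex (filterI fm fp).
Qed.

(** An ultrafilter contains one of finitely many level sets that cover a set belonging to it. *)
Lemma ulim_near (f : nat -> int) :
  (\forall k \near u, f k \in [:: -1; 0; 1]) -> \forall k \near u, f k = ulim u f.
Proof.
move=> fr.
have [n fn] : exists n, \forall k \near u, f k = n.
  have [um|um] := in_ultra_setVsetC [set k | f k = -1] uU; first by exists (-1).
  have [u0|u0] := in_ultra_setVsetC [set k | f k = 0] uU; first by exists 0.
  exists 1; apply: filterS3 fr um u0 => k /=.
  by rewrite !inE => /or3P[] /eqP.
by rewrite (ulimE fn).
Qed.

End Ulim.

(** * Degenerate triples *)

Lemma card_le2E (W : choiceType) (z1 z2 z3 : W) :
  card_le2 z1 z2 z3 = [|| z1 == z2, z2 == z3 | z1 == z3].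
Proof.
rewrite /card_le2 fsetUC cardfsU1 !inE cardfs2.
rewrite (eq_sym z3 z1) (eq_sym z3 z2).
by case: (eqVneq z1 z2) => [->|] //=; case: (z2 == z3); case: (z1 == z3).
Qed.

Lemma card_gt2P (W : choiceType) (z1 z2 z3 : W) :
  reflect [/\ z1 != z2, z2 != z3 & z1 != z3] (~~ card_le2 z1 z2 z3).
Proof. by rewrite card_le2E !negb_or; exact: and3P. Qed.

Lemma card_le2_rot (W : choiceType) (z1 z2 z3 : W) :
  card_le2 z1 z2 z3 = card_le2 z2 z3 z1.
Proof.
rewrite !card_le2E (eq_sym z3 z1) (eq_sym z2 z1).
by case: (z1 == z2); case: (z2 == z3); case: (z1 == z3).
Qed.

Lemma card_le2_swap (W : choiceType) (z1 z2 z3 : W) :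
  card_le2 z1 z3 z2 = card_le2 z1 z2 z3.
Proof.
rewrite !card_le2E (eq_sym z3 z2).
by case: (z1 == z2); case: (z2 == z3); case: (z1 == z3).
Qed.

(** * Germs and distances in a metric space *)

Section GermsInMetricSpaces.
Context {R : realType} {X : metricType R}.
Implicit Types P x y : X.

Lemma germ_pi_eq P (c c' : segment P) :
  (\pi_(germ P) c = \pi_(germ P) c') <-> agree_near0 c c'.
Proof.
split=> [/eqP|cc']; last apply/eqP.
  by rewrite [_ == _](eqmodE (germ_rel_equiv P)) => /asboolP.
by rewrite [_ == _](eqmodE (germ_rel_equiv P)); apply/asboolP.
Qed.

Lemma segment_dist P (c : segment P) s t :
  0 <= s <= segment_length c -> 0 <= t <= segment_length c ->
  mdist (c s) (c t) = `|s - t|.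
Proof. by move=> sL tL; apply: segment_geodesic; rewrite /= in_itv. Qed.

Lemma segment_dist0 P (c : segment P) t : 0 <= t <= segment_length c ->
  mdist P (c t) = t.
Proof.
move=> /andP[t0 tL].
rewrite -{1}(segment_fun0 c) segment_dist ?t0 ?lexx ?(le_trans t0)//.
by rewrite sub0r normrN ger0_norm.
Qed.

Lemma segment_dist_end P (c : segment P) t : 0 <= t <= segment_length c ->
  mdist (c t) (segment_end c) = segment_length c - t.
Proof.
move=> /andP[t0 tL]; rewrite segment_dist ?t0 ?lexx ?(le_trans t0)//.
by rewrite distrC ger0_norm// subr_ge0.
Qed.

Lemma segment_length_end P (c : segment P) :
  mdist P (segment_end c) = segment_length c.
Proof. by rewrite segment_dist0// lexx ltW// segment_length_gt0. Qed.

(** Both segments pass through a common point other than [P], and the path through it is shorter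
    than the one through [P]. *)
Lemma same_germ_dist P x y (g : germ P) : represents x g -> represents y g ->
  mdist x y < mdist P x + mdist P y.
Proof.
move=> [c <- ->] [c' <- /germ_pi_eq[e e0 cc']]; rewrite !segment_length_end.
have L0 := segment_length_gt0 c; have L0' := segment_length_gt0 c'.
pose m := Num.min e (Num.min (segment_length c) (segment_length c')).
have m0 : 0 < m by rewrite !lt_min e0 L0.
have : m / 2 < m by lra.
have s0 : 0 <= m / 2 by lra.
rewrite {2}/m !lt_min => /and3P[me mL mL'].
rewrite (le_lt_trans (metric_triangle _ (c (m / 2)) _))//.
rewrite metric_sym segment_dist_end ?s0 ?ltW// cc' ?s0//.
by rewrite segment_dist_end ?s0 ?ltW//; lra.
Qed.

(** Gromov's 0-hyperbolicity, the form in which the tree structure of the cone enters. *)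
Definition four_point_condition : Prop := forall x y z w : X,
  mdist x y + mdist z w <=
  Num.max (mdist x z + mdist y w) (mdist x w + mdist y z).

Lemma distinct_germ_dist P x y (g h : germ P) : four_point_condition ->
  represents x g -> represents y h -> g != h -> mdist x y = mdist P x + mdist P y.
Proof.
move=> four [c <- ->] [c' <- ->] gh; apply/eqP; rewrite eq_le.
rewrite (metric_sym P (segment_end c)) metric_triangle /= leNgt.
apply: contra gh => xy; apply/eqP/germ_pi_eq.
rewrite (metric_sym _ P) !segment_length_end in xy.
have L0 := segment_length_gt0 c; have L0' := segment_length_gt0 c'.
set L := segment_length c in L0 xy; set L' := segment_length c' in L0' xy.
(* [m] is the Gromov product of the two ends at [P]. If it is positive, the segments agree up to [m]
   or the end of the shorter one. *)
pose m := (L + L' - mdist (segment_end c) (segment_end c')) / 2.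
have m0 : 0 < m by rewrite /m; lra.
exists (Num.min m (Num.min L L')); first by rewrite !lt_min m0 L0.
move=> t /andP[t0]; rewrite !lt_min => /and3P[tm tL tL'].
have tc : 0 <= t <= L by rewrite t0 ltW.
have tc' : 0 <= t <= L' by rewrite t0 ltW.
(* So [c t] is no farther from the end of [c'] than [c' t] is; a second use of the four-point
   condition then forces the two points together. *)
have py : mdist (c t) (segment_end c') <= L' - t.
  have := four (c t) (segment_end c') (segment_end c) P.
  rewrite segment_dist_end// !(metric_sym _ P) !segment_length_end segment_dist0//.
  rewrite (metric_sym (segment_end c')) -/L -/L' le_max.
  by move=> /orP[]; rewrite /m in tm; lra.
apply: mdist_positivity; apply/eqP; rewrite eq_le mdist_ge0 andbT.
have := four (c t) (c' t) (segment_end c') P.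
rewrite segment_dist_end// !(metric_sym _ P) !segment_length_end !segment_dist0//.
by rewrite -/L' le_max => /orP[]; lra.
Qed.

End GermsInMetricSpaces.

(** * Inequalities between distances and their rescaled limits *)

Section ConeArithmetic.
Context {R : realType}.
Implicit Types (a b c d e f A B C D E F l t : R).

Lemma half_lt a : 0 < a -> a / 2 < a.
Proof. by lra. Qed.

(** Capitals are distances in the cone, small letters distances in the plane at scale [l], and [t]
    is the tolerance. Of the margin 6 t the errors use 4 t, and the remaining 2 t l exceeds 63. *)
Lemma four_point_arith a b c d e f A B C D E F l t : 0 < l -> 63 < l * t ->
  (A - t) * l <= a -> (B - t) * l <= b -> c <= (C + t) * l -> d <= (D + t) * l ->
  e <= (E + t) * l -> f <= (F + t) * l ->
  Num.max (C + D) (E + F) + 6 * t <= A + B ->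
  Num.max (c + d) (e + f) + 63 < a + b.
Proof.
move=> l0 lt63 Aa Bb Cc Dd Ee Ff; rewrite -lerBrDr -ltrBrDr ge_max gt_max.
move=> /andP[/(ler_wpM2r (ltW l0)) h1 /(ler_wpM2r (ltW l0)) h2].
by apply/andP; split; lra.
Qed.

Lemma sep_ge_arith a b d A B e f l : 0 <= a -> 0 <= b -> 0 < l -> 3 < l * f ->
  a <= (A + f) * l -> b <= (B + f) * l -> (A + B - f) * l <= d ->
  3 * f <= e -> 3 * f <= A -> 3 * f <= B ->
  (- (e * l) <= d - a - b) /\ (`|a - b| + 3 <= d).
Proof.
move=> a0 b0 l0 lf Aa Bb ABd.
move=> /(ler_wpM2r (ltW l0)) fe /(ler_wpM2r (ltW l0)) fA /(ler_wpM2r (ltW l0)) fB.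
split; first by lra.
by rewrite -lerBrDr ler_norml; apply/andP; split; lra.
Qed.

Lemma sep_le_arith a b d A B D m l : d <= (D + m) * l ->
  (A - m) * l <= a -> (B - m) * l <= b -> A + B - D = 4 * m ->
  d - a - b <= - (m * l).
Proof. by move=> Dd Aa Bb /(congr1 ( *%R^~ l)) /= h; lra. Qed.

End ConeArithmetic.

(** * From distances in the cone to angles along the sequences *)

Section ConeAsymptotics.
Context {R : realType} (u : set_system nat) (lam : nat -> R).
Context (uU : UltraFilter u) (uN : nonprincipal u).
Context (lamoo : lam @ \oo --> +oo) (b : nat -> hplane R).

Local Notation T := (cone uU uN lamoo b).
Local Notation pt := (\pi_(cone uU uN lamoo b)).
Implicit Types (P x y z : cone_seq u lam b) (X Y Z W : T).

Lemma nearI (A B : nat -> Prop) : (\forall k \near u, A k) ->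
  (\forall k \near u, B k) -> \forall k \near u, A k /\ B k.
Proof. by move=> uA uB; apply/near_andP. Qed.

Lemma scale_gt (m : R) : \forall k \near u, m < lam k.
Proof. by apply: (nonprincipal_cofinite uU uN); move/cvgryPgt : lamoo; exact. Qed.

Lemma expR_scale_small (C m : R) : 0 < m ->
  \forall k \near u, C * expR (- (m * lam k)) < 1.
Proof.
move=> m0; apply: filterS (scale_gt (C / m)) => k.
rewrite ltr_pdivrMr// mulrC => Ck; rewrite expRN ltr_pdivrMr ?expR_gt0// mul1r.
by rewrite (lt_le_trans Ck)// (le_trans _ (expR_ge1Dx _))// lerDr.
Qed.

Lemma mdist_ptE x y : mdist (pt x) (pt y) = lim (scaled_dist lam x y @ u).
Proof. exact: cone_dist_pi. Qed.

Lemma near_mdist x y (e : R) : 0 < e -> \forall k \near u,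
  `|hdist (x k) (y k) - mdist (pt x) (pt y) * lam k| <= e * lam k.
Proof.
move=> e0; have : cvg (scaled_dist lam x y @ u) by exact: cone_seq_cvg.
rewrite mdist_ptE => /cvgrPdist_le/(_ _ e0).
apply: filterS2 (scale_gt 0) => k k0; rewrite /scaled_dist => h.
have -> : hdist (x k) (y k) - lim (scaled_dist lam x y @ u) * lam k =
    - ((lim (scaled_dist lam x y @ u) - (lam k)^-1 * hdist (x k) (y k)) * lam k).
  by rewrite mulrBl mulrAC mulVf ?mul1r ?opprB// gt_eqF.
by rewrite normrN normrM (gtr0_norm k0) ler_pM2r.
Qed.

Lemma near_mdist_gt x y (m : R) : m < mdist (pt x) (pt y) ->
  \forall k \near u, m * lam k <= hdist (x k) (y k).
Proof.
rewrite -subr_gt0 => /(near_mdist x y); apply: filterS => k.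
by rewrite ler_distl => /andP[+ _]; rewrite -mulrBl opprB addrC subrK.
Qed.

Lemma near_mdist_lt x y (m : R) : mdist (pt x) (pt y) < m ->
  \forall k \near u, hdist (x k) (y k) <= m * lam k.
Proof.
rewrite -subr_gt0 => /(near_mdist x y); apply: filterS => k.
by rewrite ler_distl => /andP[_]; rewrite -mulrDl addrC subrK.
Qed.

Lemma near_hdist_ge x y (C : R) : pt x != pt y ->
  \forall k \near u, C <= hdist (x k) (y k).
Proof.
rewrite -mdist_gt0 => d0; have d2 := half_lt d0.
apply: filterS2 (near_mdist_gt d2) (scale_gt (C / (mdist (pt x) (pt y) / 2))).
move=> k; rewrite ltr_pdivrMr ?divr_gt0// mulrC => h1 h2.
exact: le_trans (ltW h2) h1.
Qed.

Lemma near_mdist_leD x y (e : R) : 0 < e -> \forall k \near u,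
  hdist (x k) (y k) <= (mdist (pt x) (pt y) + e) * lam k.
Proof. by move=> e0; apply: near_mdist_lt; rewrite ltrDl. Qed.

Lemma near_mdist_geB x y (e : R) : 0 < e -> \forall k \near u,
  (mdist (pt x) (pt y) - e) * lam k <= hdist (x k) (y k).
Proof. by move=> e0; apply: near_mdist_gt; rewrite gtrBl. Qed.

Lemma cone_four_point : @four_point_condition R T.
Proof.
(* Coinciding pairs reduce to the triangle inequality. Distinct points of the cone are eventually at
   distance at least 3, as [four_point] requires. *)
move=> X Y Z W; have [->|XY] := eqVneq X Y.
  by rewrite mdistxx add0r le_max (metric_sym Y Z) metric_triangle.
have [->|ZW] := eqVneq Z W.
  by rewrite mdistxx addr0 le_max (metric_sym Y W) metric_triangle.
rewrite leNgt; apply/negP; set M := Num.max _ _ => lt.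
pose e := (mdist X Y + mdist Z W - M) / 6.
have e0 : 0 < e by rewrite divr_gt0// subr_gt0.
have eE : M + 6 * e <= mdist X Y + mdist Z W.
  by rewrite mulrC divfK// addrC subrK.
clearbody e; clear lt; rewrite {}/M in eE; move: e e0 eE XY ZW.
rewrite -(reprK X) -(reprK Y) -(reprK Z) -(reprK W).
move: (repr X) (repr Y) (repr Z) (repr W) => {X Y Z W} x y z w e e0 eE xy zw.
have I1 := nearI (near_mdist_geB x y e0) (near_mdist_geB z w e0).
have I2 := nearI (near_mdist_leD x z e0) (near_mdist_leD y w e0).
have I3 := nearI (near_mdist_leD x w e0) (near_mdist_leD y z e0).
have I4 := nearI (near_hdist_ge 3 xy) (near_hdist_ge 3 zw).
have I5 := nearI (scale_gt 0) (scale_gt (63 / e)).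
have [k] := filter_ex (nearI (nearI I1 I2) (nearI (nearI I3 I4) I5)).
move=> [[[xy1 zw1] [xz yw]] [[[xw yz] [xy3 zw3]] [l0]]].
rewrite ltr_pdivrMr// => l1.
have := four_point xy3 zw3; rewrite leNgt => /negP; apply.
exact: four_point_arith l0 l1 xy1 zw1 xz yw xw yz eE.
Qed.

Lemma hdist_ge1_neq (p q : hplane R) : 1 <= hdist p q -> q != p.
Proof. by move=> h; rewrite eq_sym -hdist_gt0 (lt_le_trans ltr01). Qed.

(** Additivity of the distances means that the rescaled Gromov product at [P] vanishes in the limit,
    so the angle decays more slowly than any exponential in [lam k]. *)
Lemma near_sep_ge P x y (e : R) : pt P != pt x -> pt P != pt y ->
  mdist (pt x) (pt y) = mdist (pt P) (pt x) + mdist (pt P) (pt y) -> 0 < e ->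
  \forall k \near u, expR (- (e * lam k)) <= sep (dir (P k) (x k)) (dir (P k) (y k)).
Proof.
move=> Px Py xy e0.
have := Px; rewrite -mdist_gt0 => x0; have := Py; rewrite -mdist_gt0 => y0.
pose f := Num.min e (Num.min (mdist (pt P) (pt x)) (mdist (pt P) (pt y))) / 3.
have f0 : 0 < f by rewrite /f divr_gt0// !lt_min e0 x0.
have : 3 * f <= Num.min e (Num.min (mdist (pt P) (pt x)) (mdist (pt P) (pt y))).
  by rewrite mulrC divfK.
rewrite !le_min => /and3P[fe fx fy]; clearbody f.
have I1 := nearI (scale_gt 0) (scale_gt (3 / f)).
have I2 := nearI (near_hdist_ge 1 Px) (near_hdist_ge 1 Py).
have I3 := nearI (near_mdist_leD P x f0) (near_mdist_leD P y f0).
have I4 := nearI I3 (near_mdist_geB x y f0).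
apply: filterS (nearI (nearI I1 I2) I4) => k [[[l0 l1] [x1 y1]] [[hx hy] hxy]].
move: l1; rewrite ltr_pdivrMr// => l1; rewrite xy in hxy.
have [h1 h2] := sep_ge_arith (hdist_ge0 _ _) (hdist_ge0 _ _) l0 l1 hx hy hxy fe fx fy.
apply: le_trans (sep_dir_ge _ _ h2); rewrite ?hdist_ge1_neq//.
by rewrite ler_expR.
Qed.

Lemma near_sep_le P x y : pt P != pt x -> pt P != pt y ->
  mdist (pt x) (pt y) < mdist (pt P) (pt x) + mdist (pt P) (pt y) ->
  exists2 m : R, 0 < m & \forall k \near u,
    sep (dir (P k) (x k)) (dir (P k) (y k)) <= 16 * expR (- (m * lam k)).
Proof.
move=> Px Py xy.
(* A quarter of the defect: the three distance errors consume three quarters, and the last one is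
   the decay rate. *)
pose m := (mdist (pt P) (pt x) + mdist (pt P) (pt y) - mdist (pt x) (pt y)) / 4.
have m0 : 0 < m by rewrite divr_gt0// subr_gt0.
have mE : mdist (pt P) (pt x) + mdist (pt P) (pt y) - mdist (pt x) (pt y) = 4 * m.
  by rewrite mulrC divfK.
exists m => //; clearbody m.
have I1 := nearI (near_hdist_ge 1 Px) (near_hdist_ge 1 Py).
have I2 := nearI (near_mdist_geB P x m0) (near_mdist_geB P y m0).
apply: filterS (nearI (nearI I1 I2) (near_mdist_leD x y m0)).
move=> k [[[x1 y1] [hx hy]] hxy].
apply: (le_trans (sep_dir_le x1 y1)); rewrite ler_pM2l// ler_expR.
exact: sep_le_arith hxy hx hy mE.
Qed.

End ConeAsymptotics.

(** * The limit orientation and its axioms *)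

Section LimitOfOrientations.
Context {R : realType} (u : set_system nat) (lam : nat -> R).
Context (uU : UltraFilter u) (uN : nonprincipal u).
Context (lamoo : lam @ \oo --> +oo) (b : nat -> hplane R).

Local Notation T := (cone uU uN lamoo b).
Local Notation pt := (\pi_(cone uU uN lamoo b)).
Implicit Types (P x y z : cone_seq u lam b) (Q X Y Z : T).

(* [Q] is the centre of the tripod spanned by [X], [Y] and [Z]. *)
Definition tripod Q X Y Z : Prop :=
  [/\ [/\ Q != X, Q != Y & Q != Z], mdist X Y = mdist Q X + mdist Q Y,
      mdist Y Z = mdist Q Y + mdist Q Z & mdist Z X = mdist Q Z + mdist Q X].

Lemma tripod_rot Q X Y Z : tripod Q X Y Z -> tripod Q Y Z X.
Proof. by case=> -[]. Qed.

Lemma expR_cube (t : R) : expR (- t) * expR (- t) * expR (- t) = expR (- (3 * t)).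
Proof. by rewrite -!expRD; congr expR; ring. Qed.

Lemma near_tripod_sep P x y z (e : R) : tripod (pt P) (pt x) (pt y) (pt z) ->
  0 < e -> \forall k \near u,
  [/\ 1 <= hdist (P k) (x k), 1 <= hdist (P k) (y k), 1 <= hdist (P k) (z k) &
    expR (- (3 * (e * lam k))) <= sep (dir (P k) (x k)) (dir (P k) (y k)) *
      sep (dir (P k) (y k)) (dir (P k) (z k)) *
      sep (dir (P k) (z k)) (dir (P k) (x k))].
Proof.
move=> [[Px Py Pz] xy yz zx] e0.
have I1 := nearI uU (near_hdist_ge 1 Px) (near_hdist_ge 1 Py).
have I2 := nearI uU (near_sep_ge Px Py xy e0) (near_sep_ge Py Pz yz e0).
have I3 := nearI uU (near_hdist_ge 1 Pz) (near_sep_ge Pz Px zx e0).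
apply: filterS (nearI uU I1 (nearI uU I2 I3)) => k [[x1 y1] [[sxy syz] [z1 szx]]].
split=> //; rewrite -expR_cube.
by rewrite ler_pM ?mulr_ge0 ?expR_ge0// ler_pM ?expR_ge0.
Qed.

Lemma near_hor_neq0 P x y z : tripod (pt P) (pt x) (pt y) (pt z) ->
  \forall k \near u, hor_point (P k) (x k) (y k) (z k) != 0.
Proof.
move=> tri; apply: filterS (near_tripod_sep tri ltr01) => k [x1 y1 z1 h].
rewrite hor_pointE ?hdist_ge1_neq// circle_order_neq0 ?dir_unit ?hdist_ge1_neq//.
exact: lt_le_trans (expR_gt0 _) h.
Qed.

(* Moving one point inside its germ rotates its direction by an exponentially
   small angle, while the angles between distinct germs are subexponential. *)
Lemma near_hor_same_germ P x x' y z : tripod (pt P) (pt x) (pt y) (pt z) ->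
  pt P != pt x' -> mdist (pt x) (pt x') < mdist (pt P) (pt x) + mdist (pt P) (pt x') ->
  \forall k \near u, hor_point (P k) (x' k) (y k) (z k) =
                     hor_point (P k) (x k) (y k) (z k).
Proof.
move=> tri Px' xx'; have [[Px Py Pz] _ _ _] := tri.
have [m m0 close] := near_sep_le Px Px' xx'.
(* With tolerance m / 6 the product of the three separations is at least exp(- (m / 2) lam k). The
   perturbation 4 * 16 exp(- m lam k) is smaller once 64 exp(- (m / 2) lam k) < 1. *)
have m6 : 0 < m / 6 by rewrite divr_gt0.
have m2 : 0 < m / 2 by rewrite divr_gt0.
have I1 := nearI uU close (near_hdist_ge 1 Px').
have I2 := nearI uU (near_tripod_sep tri m6) (expR_scale_small uU uN lamoo 64 m2).
apply: filterS (nearI uU I1 I2) => k [[sxx' x'1] [[x1 y1 z1 h] small]].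
rewrite !hor_pointE ?hdist_ge1_neq//.
apply: circle_order_perturb; rewrite ?dir_unit ?hdist_ge1_neq//.
apply: lt_le_trans h.
apply: (@le_lt_trans _ _ (4 * (16 * expR (- (m * lam k))))); first by rewrite ler_pM2l.
have -> : 3 * (m / 6 * lam k) = m / 2 * lam k by field.
have -> : - (m * lam k) = - (m / 2 * lam k) + - (m / 2 * lam k) by field.
by rewrite expRD !mulrA -natrM -[ltRHS]mul1r ltr_pM2r ?expR_gt0.
Qed.

(* The right-hand side does not mention [P]. *)
Lemma near_hor_orientation P x y z : tripod (pt P) (pt x) (pt y) (pt z) ->
  \forall k \near u, hor_point (P k) (x k) (y k) (z k) =
    sgz (det3 (lift (hval (x k))) (lift (hval (y k))) (lift (hval (z k)))).
Proof.
move=> tri; have [[Px Py Pz] _ _ _] := tri.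
pose D := Num.min (mdist (pt P) (pt x))
  (Num.min (mdist (pt P) (pt y)) (mdist (pt P) (pt z))).
have D0 : 0 < D by rewrite !lt_min !mdist_gt0 Px Py.
have := half_lt D0; set d := D / 2; have d0 : 0 < d by rewrite divr_gt0.
rewrite !lt_min => /and3P[dx dy dz]; clearbody d.
have I1 := nearI uU (near_mdist_gt dx) (near_mdist_gt dy).
(* The squared error 9 * 16 exp(- 4 d lam k) must stay below 2 exp(- 3 d lam k), that is, 72 exp(- d
   lam k) < 1. *)
have I2 := nearI uU (near_tripod_sep tri d0) (expR_scale_small uU uN lamoo 72 d0).
apply: filterS (nearI uU (nearI uU I1 (near_mdist_gt dz)) I2).
move=> k [[[hx hy] hz] [[x1 y1 z1 h] small]].
rewrite hor_pointE ?hdist_ge1_neq//.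
have le (t : R) : d * lam k <= t ->
    4 * expR (- (2 * t)) <= 4 * expR (- (2 * (d * lam k))).
  by move=> dt; rewrite ler_pM2l// ler_expR lerN2 ler_pM2l.
apply/esym/(orientation_dir x1 y1 z1 (le _ hx) (le _ hy) (le _ hz)).
have : 2 * expR (- (3 * (d * lam k))) <=
    2 * (sep (dir (P k) (x k)) (dir (P k) (y k)) *
      sep (dir (P k) (y k)) (dir (P k) (z k)) *
      sep (dir (P k) (z k)) (dir (P k) (x k))) by rewrite ler_pM2l.
apply: lt_le_trans.
rewrite exprMn -expRM_natl.
have -> : 2%:R * - (2 * (d * lam k)) = - (d * lam k) + - (3 * (d * lam k)) by ring.
rewrite expRD.
have -> : 9 * (4 ^+ 2 * (expR (- (d * lam k)) * expR (- (3 * (d * lam k))))) =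
  2 * (72 * expR (- (d * lam k)) * expR (- (3 * (d * lam k)))) by ring.
by rewrite ltr_pM2l// -[ltRHS]mul1r ltr_pM2r ?expR_gt0.
Qed.

Lemma near_hor_rot P x y z : tripod (pt P) (pt x) (pt y) (pt z) ->
  \forall k \near u, hor_point (P k) (x k) (y k) (z k) =
                     hor_point (P k) (y k) (z k) (x k).
Proof.
move=> tri; apply: filterS (near_tripod_sep tri ltr01) => k [x1 y1 z1 _].
by rewrite !hor_pointE ?hdist_ge1_neq// circle_order_rot.
Qed.

Lemma germs_tripod (P : T) X Y Z (g1 g2 g3 : germ P) :
  represents X g1 -> represents Y g2 -> represents Z g3 ->
  ~~ card_le2 g1 g2 g3 -> tripod P X Y Z.
Proof.
move=> X1 Y2 Z3; case/card_gt2P => g12 g23 g13.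
have four := @cone_four_point R u lam uU uN lamoo b.
split.
- by split; rewrite eq_sym;
    [exact: represents_neq X1|exact: represents_neq Y2|exact: represents_neq Z3].
- exact: (distinct_germ_dist four X1 Y2 g12).
- exact: (distinct_germ_dist four Y2 Z3 g23).
- by apply: (distinct_germ_dist four Z3 X1); rewrite eq_sym.
Qed.

Lemma near_hor_move (Q : T) (g1 g2 g3 : germ Q) P x x' y z : pt P = Q ->
  represents (pt x) g1 -> represents (pt x') g1 -> represents (pt y) g2 ->
  represents (pt z) g3 -> ~~ card_le2 g1 g2 g3 ->
  \forall k \near u, hor_point (P k) (x' k) (y k) (z k) =
                     hor_point (P k) (x k) (y k) (z k).
Proof.
move=> PQ x1 x'1 y2 z3 g123.
apply: near_hor_same_germ; rewrite PQ.
- exact: germs_tripod x1 y2 z3 g123.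
- by rewrite eq_sym; exact: represents_neq x'1.
- exact: same_germ_dist x1 x'1.
Qed.

(** The base sequence is changed first, by comparison with the determinant of the lifts. Then the
    three points are changed one at a time, each rotated into the first slot. *)
Lemma near_hor_eq (Q : T) (g1 g2 g3 : germ Q) P P' x x' y y' z z' :
  pt P = Q -> pt P' = Q ->
  represents (pt x) g1 -> represents (pt x') g1 ->
  represents (pt y) g2 -> represents (pt y') g2 ->
  represents (pt z) g3 -> represents (pt z') g3 -> ~~ card_le2 g1 g2 g3 ->
  \forall k \near u, hor_point (P' k) (x' k) (y' k) (z' k) =
                     hor_point (P k) (x k) (y k) (z k).
Proof.
move=> PQ P'Q x1 x1' y2 y2' z3 z3' g123.
have g231 : ~~ card_le2 g2 g3 g1 by rewrite -card_le2_rot.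
have g312 : ~~ card_le2 g3 g1 g2 by rewrite -card_le2_rot.
have tri S a c d : pt S = Q -> represents (pt a) g1 -> represents (pt c) g2 ->
    represents (pt d) g3 -> tripod (pt S) (pt a) (pt c) (pt d).
  by move=> -> a1 c2 d3; exact: germs_tripod a1 c2 d3 g123.
have H1 := near_hor_orientation (tri _ _ _ _ PQ x1 y2 z3).
have H2 := near_hor_orientation (tri _ _ _ _ P'Q x1 y2 z3).
have H3 := near_hor_move P'Q x1 x1' y2 z3 g123.
have R3 := near_hor_rot (tri _ _ _ _ P'Q x1' y2 z3).
have H4 := near_hor_move P'Q y2 y2' z3 x1' g231.
have R4 := near_hor_rot (tripod_rot (tri _ _ _ _ P'Q x1' y2' z3)).
have H5 := near_hor_move P'Q z3 z3' x1' y2' g312.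
have R5 := near_hor_rot (tripod_rot (tripod_rot (tri _ _ _ _ P'Q x1' y2' z3'))).
have I1 := nearI uU (nearI uU H1 H2) (nearI uU H3 R3).
have I2 := nearI uU (nearI uU H4 R4) (nearI uU H5 R5).
apply: filterS (nearI uU I1 I2) => k [[[h1 h2] [h3 r3]] [[h4 r4] [h5 r5]]].
by rewrite h1 -h2 -h3 r3 -h4 r4 -h5 r5.
Qed.

Lemma represents_repr (Q : T) (g : germ Q) :
  represents (pt (repr (germ_point g))) g.
Proof. by rewrite reprK; exact: germ_pointP. Qed.

Lemma tripod_repr (Q : T) (g1 g2 g3 : germ Q) : ~~ card_le2 g1 g2 g3 ->
  tripod (pt (repr Q)) (pt (repr (germ_point g1)))
    (pt (repr (germ_point g2))) (pt (repr (germ_point g3))).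
Proof.
move=> g123; rewrite [pt (repr Q)]reprK.
by apply: germs_tripod g123; exact: represents_repr.
Qed.

Lemma near_cone_or (Q : T) (g1 g2 g3 : germ Q) P x y z : pt P = Q ->
  represents (pt x) g1 -> represents (pt y) g2 -> represents (pt z) g3 ->
  ~~ card_le2 g1 g2 g3 ->
  \forall k \near u, hor_point (P k) (x k) (y k) (z k) = cone_or g1 g2 g3.
Proof.
move=> PQ x1 y2 z3 g123; rewrite /cone_or (negbTE g123).
have H := near_hor_eq (reprK Q) PQ (represents_repr g1) x1
  (represents_repr g2) y2 (represents_repr g3) z3 g123.
have range : \forall k \near u, hor_point (repr Q k) (repr (germ_point g1) k)
    (repr (germ_point g2) k) (repr (germ_point g3) k) \in [:: -1; 0; 1].
  apply: filterS (near_tripod_sep (tripod_repr g123) ltr01) => k [h1 h2 h3 _].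
  by rewrite hor_pointE ?hdist_ge1_neq// circle_order_range.
by apply: filterS2 H (ulim_near uU range) => k -> <-.
Qed.

(** The vector attached to a germ does not depend on the triple it sits in. Finitely many values of
    [cone_or] are therefore computed on the circle at one common index, where the axioms hold. *)
Lemma near_cone_or_dir (Q : T) (g1 g2 g3 : germ Q) : ~~ card_le2 g1 g2 g3 ->
  let v k (g : germ Q) := dir (repr Q k) (repr (germ_point g) k) in
  \forall k \near u,
    [/\ circle_order (v k g1) (v k g2) (v k g3) = cone_or g1 g2 g3,
        cone_or g1 g2 g3 != 0, sqnorm2 (v k g1) = 1, sqnorm2 (v k g2) = 1 &
        sqnorm2 (v k g3) = 1].
Proof.
move=> g123 v.
have H := near_cone_or (reprK Q) (represents_repr g1) (represents_repr g2)
  (represents_repr g3) g123.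
have tri := tripod_repr g123.
apply: filterS3 H (near_hor_neq0 tri) (near_tripod_sep tri ltr01).
move=> k <- n0 [h1 h2 h3 _].
by split; rewrite /v ?dir_unit ?hdist_ge1_neq// -hor_pointE ?hdist_ge1_neq.
Qed.

Lemma cone_or_cyclic (Q : T) : cyclic_order (@cone_or R u lam uU uN lamoo b Q).
Proof.
have deg (g1 g2 g3 : germ Q) : card_le2 g1 g2 g3 -> cone_or g1 g2 g3 = 0.
  by rewrite /cone_or => ->.
have rot (g1 g2 g3 : germ Q) : cone_or g1 g2 g3 = cone_or g2 g3 g1.
  have [le2|gt2] := boolP (card_le2 g1 g2 g3).
    by rewrite !deg// -card_le2_rot.
  have gt2' : ~~ card_le2 g2 g3 g1 by rewrite -card_le2_rot.
  have [k [[<- _ _ _ _] [<- _ _ _ _]]] :=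
    filter_ex (nearI uU (near_cone_or_dir gt2) (near_cone_or_dir gt2')).
  exact: circle_order_rot.
have swap (g1 g2 g3 : germ Q) : cone_or g1 g3 g2 = - cone_or g1 g2 g3.
  have [le2|gt2] := boolP (card_le2 g1 g2 g3).
    by rewrite !deg ?oppr0// card_le2_swap.
  have gt2' : ~~ card_le2 g1 g3 g2 by rewrite card_le2_swap.
  have [k [[<- _ _ _ _] [<- _ _ _ _]]] :=
    filter_ex (nearI uU (near_cone_or_dir gt2) (near_cone_or_dir gt2')).
  exact: circle_order_swap.
have nondeg (g1 g2 g3 : germ Q) : cone_or g1 g2 g3 = 1 -> ~~ card_le2 g1 g2 g3.
  by move=> o1; apply/negP => /deg; rewrite o1.
split=> [g1 g2 g3|g1 g2 g3||g1 g2 g3|g1 g2 g3 g4 o123 o134].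
- have [le2|gt2] := boolP (card_le2 g1 g2 g3); first by rewrite deg.
  have [k [<- _ _ _ _]] := filter_ex (near_cone_or_dir gt2).
  exact: circle_order_range.
- split; [move=> o0|exact: deg]; apply/negPn/negP => gt2.
  by have [k [_]] := filter_ex (near_cone_or_dir gt2); rewrite o0.
- exact: rot.
- by rewrite -rot (swap g1 g2 g3) opprK.
- have n123 := nondeg _ _ _ o123; have n134 := nondeg _ _ _ o134.
  (* If [g2] were [g4], the two hypotheses would contradict antisymmetry. *)
  have n124 : ~~ card_le2 g1 g2 g4.
    have [g12 _ _] := card_gt2P _ _ _ n123.
    have [_ _ g14] := card_gt2P _ _ _ n134.
    apply/card_gt2P; split=> //; apply/eqP => g24.
    by move: o134; rewrite -g24 (swap g1 g2 g3) o123.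
  have I := nearI uU (near_cone_or_dir n123) (near_cone_or_dir n134).
  have [k [[[e1 _ u1 u2 u3] [e2 _ _ _ u4]] [<- _ _ _ _]]] :=
    filter_ex (nearI uU I (near_cone_or_dir n124)).
  by apply: circle_order_trans u1 u2 u3 u4 _ _; rewrite ?e1 ?e2.
Qed.

End LimitOfOrientations.

(** Since [cone_or] is evaluated on chosen sequences, the first conjunct records that the limit
    formula holds for all representatives of the base point and of the germs. *)
Theorem theorem3p29 (R : realType) (u : set_system nat)
    (uU : UltraFilter u) (uN : nonprincipal u)
    (lam : nat -> R) (lamoo : lam @ \oo --> +oo) (b : nat -> hplane R) :
  (forall (P x y z : cone_seq u lam b)
      (g1 g2 g3 : germ (\pi_(cone uU uN lamoo b) P)),
    represents (\pi_(cone uU uN lamoo b) x) g1 ->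
    represents (\pi_(cone uU uN lamoo b) y) g2 ->
    represents (\pi_(cone uU uN lamoo b) z) g3 ->
    if card_le2 g1 g2 g3 then cone_or g1 g2 g3 = 0
    else \forall k \near u,
      hor_point (P k) (x k) (y k) (z k) = cone_or g1 g2 g3) /\
  orientation (fun P : cone uU uN lamoo b => @cone_or R u lam uU uN lamoo b P).
Proof.
split=> [P x y z g1 g2 g3 x1 y2 z3|]; last exact: cone_or_cyclic.
case: ifPn => [le2|gt2]; first by rewrite /cone_or le2.
exact: near_cone_or x1 y2 z3 gt2.
Qed.
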